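(* In the triangular-array exponential family setting described in the context (with $d\to\infty$ as $n\to\infty$), suppose that for any fixed value $c>0$ the following hold: (i) $B_{1n}(c)\sqrt{d/n}=o(1)$; (ii) $\lambda_n(c)\,d=o(1)$; (iii) $\|F^{-1}\|_{op}\,d/n=o(1)$; (iv) the prior $\pi$ satisfies Assumption P($c$). Then the posterior density in the local parameter space is asymptotically normal: $$\int_{\mathcal U}\left|\pi_n^*(u)-\phi_d(u;\Delta_n,I_d)\right|du=o_p(1).$$
   Context: All objects may depend on $n$ (triangular array); asymptotics are as $n\to\infty$. For each $n$, $\Theta\subset\mathbb R^d$ is open and convex, $d=d^{(n)}\to\infty$, and $X_1,\dots,X_n$ are i.i.d. $d$-dimensional vectors with density (with respect to a fixed dominating measure) $f(x;\theta)=h(x)\exp(\langle x,\theta\rangle-\psi(\theta))$ at the true parameter $\theta=\theta_0\in\Theta$, where $\psi$ is the (convex) normalizing function. Let $\mu=\psi'(\theta_0)$ and $F=\psi''(\theta_0)$ be the mean and the (invertible) covariance matrix of $X_i$, and $J=F^{1/2}$ the symmetric square root. $\|\cdot\|$ is the Euclidean norm, $\|\cdot\|_{op}$ the operator norm, $S^{d-1}$ the unit sphere, $B_d(\bar\theta,\varepsilon)$ the closed Euclidean ball. It is assumed that $B_d(\theta_0,\sqrt{d\|F^{-1}\|_{op}/n}\,\log n)\subset\Theta$. $\phi_d(\cdot;m,V)$ is the $d$-dimensional Gaussian density with mean $m$ and covariance $V$. Let $\mathcal U=\sqrt n J(\Theta-\theta_0)$ and $\Delta_n=\sqrt n J^{-1}\big(\frac1n\sum_{i=1}^nX_i-\mu\big)$.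 For a (possibly improper) prior density $\pi$ on $\Theta$, the posterior in the local parameter space is, for $u\in\mathcal U$, $$\pi_n^*(u)=\frac{\pi(\theta_0+n^{-1/2}J^{-1}u)\prod_{i=1}^nf(X_i;\theta_0+n^{-1/2}J^{-1}u)}{\int_{\mathcal U}\pi(\theta_0+n^{-1/2}J^{-1}v)\prod_{i=1}^nf(X_i;\theta_0+n^{-1/2}J^{-1}v)\,dv}.$$ For $\theta\in\Theta$ let $V=J^{-1}(U-E_\theta[U])$ with $U\sim f(\cdot;\theta)$. For $c\ge 0$, $$B_{1n}(c)=\sup\{|E_\theta[\langle a,V\rangle^3]|:a\in S^{d-1},\ \theta\in\Theta,\ \|J(\theta-\theta_0)\|^2\le cd/n\},$$ $$B_{2n}(c)=\sup\{E_\theta[\langle a,V\rangle^4]:a\in S^{d-1},\ \theta\in\Theta,\ \|J(\theta-\theta_0)\|^2\le cd/n\},$$ $$\lambda_n(c)=\tfrac16\Big(\sqrt{\tfrac{cd}{n}}\,B_{1n}(0)+\tfrac{cd}{n}B_{2n}(c)\Big).$$ Assumption P($c_n$), for a positive sequence $c_n$: $\sup_{\theta\in\Theta}\ln[\pi(\theta)/\pi(\theta_0)]\le O(d)$, and $|\ln\pi(\theta)-\ln\pi(\theta_0)|\le K_n(c_n)\|\theta-\theta_0\|$ for every $\theta$ with $\|\theta-\theta_0\|\le\sqrt{c_n\|F^{-1}\|_{op}d/n}$, where $K_n(c_n)\sqrt{c_n\|F^{-1}\|_{op}d/n}=o(1)$. *)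

(* Defs.v *)
From HB Require Import structures.
From mathcomp Require Import all_boot all_order all_algebra.
From mathcomp Require Import all_classical all_reals all_analysis.

Set Implicit Arguments.
Unset Strict Implicit.
Unset Printing Implicit Defensive.

Import Order.TTheory GRing.Theory Num.Theory.
Import numFieldNormedType.Exports.

Local Open Scope classical_set_scope.
Local Open Scope ring_scope.

Definition measure_cV_display : measure_display.
Proof. exact: default_measure_display. Qed.

Definition cV_coord (R : realType) (n : nat) (i : 'I_n) (x : 'cV[R]_n) : R :=
  x i 0.

Definition cV_measurable (R : realType) (n : nat) : set (set 'cV[R]_n) :=
  g_sigma_preimage (@cV_coord R n).

Lemma cV_measurable0 (R : realType) (n : nat) : @cV_measurable R n set0.
Proof. exact: sigma_algebra0. Qed.

Lemma cV_measurableC (R : realType) (n : nat) (A : set 'cV[R]_n) :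
  cV_measurable A -> cV_measurable (~` A).
Proof. exact: sigma_algebraC. Qed.

Lemma cV_measurable_bigcup (R : realType) (n : nat) (F : (set 'cV[R]_n)^nat) :
  (forall i, cV_measurable (F i)) -> cV_measurable (\bigcup_i F i).
Proof. exact: sigma_algebra_bigcup. Qed.

(* This is the Borel sigma-algebra of 'cV[R]_n, given by its generation by the
   coordinates. *)
HB.instance Definition _ (R : realType) (n : nat) :=
  @isMeasurable.Build measure_cV_display 'cV[R]_n (@cV_measurable R n)
    (@cV_measurable0 R n) (@cV_measurableC R n) (@cV_measurable_bigcup R n).

Lemma measurable_cV_coord (R : realType) (n : nat) (i : 'I_n) :
  measurable_fun [set: 'cV[R]_n] (cV_coord i).
Proof.
move=> _ Y mY; rewrite setTI; apply: sub_sigma_algebra => /=.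
rewrite -bigcup_seq/=; exists i => /=; first by rewrite mem_index_enum.
by exists Y => //; rewrite setTI.
Qed.

Lemma measurable_fun_cVP (d : measure_display) (T : measurableType d)
    (R : realType) (n : nat) (f : T -> 'cV[R]_n) :
  measurable_fun setT f <->
  forall i, measurable_fun setT (cV_coord i \o f).
Proof.
split=> [mf i|mf].
  by apply: measurableT_comp => //; exact: measurable_cV_coord.
apply: (@iffRL _ (g_sigma_preimage (fun i => cV_coord i \o f) `<=` measurable)).
  rewrite g_sigma_preimage_comp; split=> [mf' A [/= C preC <-]|prefS].
    exact: mf'.
  by move=> _ A mA; apply: prefS; exists A.
apply: smallest_sub; first exact: sigma_algebra_measurable.
case: n => [|n] in f mf *; first by rewrite big_ord0.
rewrite -bigcup_mkord_ord; apply: bigcup_sub => i Ii.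
by move=> A [B mB <-]; exact: mf.
Qed.

Definition cV_cons (R : realType) (n : nat) (p : measurableTypeR R * 'cV[R]_n) :
  'cV[R]_n.+1 := \col_i if unlift 0 i is Some j then p.2 j 0 else p.1.

Definition cV_uncons (R : realType) (n : nat) (x : 'cV[R]_n.+1) :
  measurableTypeR R * 'cV[R]_n := (x 0 0, \col_j x (lift 0 j) 0).

Lemma cV_consK (R : realType) (n : nat) : cancel (@cV_cons R n) (@cV_uncons R n).
Proof.
move=> [a x]; congr pair; first by rewrite mxE unlift_none.
by apply/matrixP => i j; rewrite !mxE liftK ord1.
Qed.

Lemma measurable_cV_cons (R : realType) (n : nat) :
  measurable_fun setT (@cV_cons R n).
Proof.
apply/measurable_fun_cVP => i; case: (unliftP 0 i) => [j ->|->].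
  rewrite (_ : _ \o _ = cV_coord j \o snd).
    by apply: measurableT_comp => //; exact: measurable_cV_coord.
  by apply/funext => -[a x]; rewrite /= /cV_coord mxE liftK.
rewrite (_ : _ \o _ = fst)//.
by apply/funext => -[a x]; rewrite /= /cV_coord mxE unlift_none.
Qed.

Lemma measurable_cV_uncons (R : realType) (n : nat) :
  measurable_fun setT (@cV_uncons R n).
Proof.
apply/measurable_fun_pairP; split; first exact: (measurable_cV_coord (0 : 'I_n.+1)).
apply/measurable_fun_cVP => i.
rewrite (_ : _ \o _ = cV_coord (lift 0 i)); first exact: measurable_cV_coord.
by apply/funext => x; rewrite /= /cV_coord mxE.
Qed.

Lemma product_sigma_finite (d1 d2 : measure_display) (T1 : measurableType d1)
    (T2 : measurableType d2) (R : realType)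
    (m1 : {sigma_finite_measure set T1 -> \bar R})
    (m2 : {sigma_finite_measure set T2 -> \bar R}) :
  sigma_finite setT (m1 \x m2)%E.
Proof.
have /sigma_finiteP[F [TF ndF Foo]] := sigma_finiteT m1.
have /sigma_finiteP[G [TG ndG Goo]] := sigma_finiteT m2.
exists (fun n => F n `*` G n).
  rewrite -setXTT TF TG predeqE => -[x y]; split.
    move=> [/= [n _ Fnx] [k _ Gky]]; exists (maxn n k) => //; split.
    - by move: x Fnx; exact/subsetPset/ndF/leq_maxl.
    - by move: y Gky; exact/subsetPset/ndG/leq_maxr.
  by move=> [n _ []/= ? ?]; split; exists n.
move=> k; have [? ?] := Foo k; have [? ?] := Goo k.
split; first exact: measurableX.
by rewrite product_measure1E// lte_mul_pinfty// ge0_fin_numE.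
Qed.

Definition lebesgue_cVS (R : realType) (n : nat)
    (m : {sigma_finite_measure set 'cV[R]_n -> \bar R}) :
    set 'cV[R]_n.+1 -> \bar R :=
  pushforward (lebesgue_measure \x m)%E (@cV_cons R n).

HB.instance Definition _ (R : realType) (n : nat)
    (m : {sigma_finite_measure set 'cV[R]_n -> \bar R}) :=
  Measure.copy (lebesgue_cVS m)
    (measure_function_pushforward__canonical__measure_function_Measure
       (lebesgue_measure \x m)%E (@measurable_cV_cons R n)).

Lemma lebesgue_cVS_sigma_finite (R : realType) (n : nat)
    (m : {sigma_finite_measure set 'cV[R]_n -> \bar R}) :
  sigma_finite setT (lebesgue_cVS m).
Proof.
have [F FT mF] : sigma_finite setT (lebesgue_measure \x m)%E.
  exact: product_sigma_finite.
exists (fun i => @cV_uncons R n @^-1` F i).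
  by rewrite -preimage_bigcup -FT preimage_setT.
move=> i; have [mFi Fi] := mF i; split.
  by rewrite -[X in measurable X]setTI; exact: measurable_cV_uncons.
rewrite /lebesgue_cVS /pushforward -comp_preimage.
by rewrite (_ : _ \o _ = id)//; apply/funext => x /=; rewrite cV_consK.
Qed.

HB.instance Definition _ (R : realType) (n : nat)
    (m : {sigma_finite_measure set 'cV[R]_n -> \bar R}) :=
  Measure_isSigmaFinite.Build _ _ _ (lebesgue_cVS m)
    (@lebesgue_cVS_sigma_finite R n m).

(* Lebesgue measure on R^n, as an iterated product measure. *)
Fixpoint lebesgue_cV (R : realType) (n : nat) :
    {sigma_finite_measure set 'cV[R]_n -> \bar R} :=
  match n with
  | 0 => @dirac _ _ (0 : 'cV[R]_0) R
  | n'.+1 => lebesgue_cVS (lebesgue_cV R n')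
  end.

Lemma measurable_cV_box (R : realType) (n : nat) (A : 'I_n -> set R) :
  (forall i, measurable (A i)) ->
  measurable [set x : 'cV[R]_n | forall i, A i (x i 0)].
Proof.
move=> mA; rewrite (_ : mkset _ = \bigcap_(k in [set: nat])
    if insub k is Some i then cV_coord i @^-1` A i else setT).
  apply: bigcap_measurableType => k _; case: insubP => // i _ _.
  by rewrite -[X in measurable X]setTI; exact: measurable_cV_coord.
apply/seteqP; split=> [x Ax k _|x Ax i].
  by case: insubP => // i _ _; exact: Ax.
by have := Ax i I; rewrite valK.
Qed.

Lemma lebesgue_cV_box (R : realType) (n : nat) (A : 'I_n -> set R) :
  (forall i, measurable (A i)) ->
  lebesgue_cV R n [set x | forall i, A i (x i 0)] =
  (\prod_(i < n) lebesgue_measure (A i))%E.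
Proof.
elim: n A => [|n IH] A mA.
  by rewrite big_ord0 /= diracE mem_set// => -[].
rewrite big_ord_recl -IH; last by move=> i; exact: mA.
have mB : measurable [set x : 'cV[R]_n | forall i, A (lift ord0 i) (x i 0)].
  by apply: (@measurable_cV_box R n (fun i => A (lift ord0 i))) => i; exact: mA.
rewrite -[RHS](product_measure1E lebesgue_measure (lebesgue_cV R n) (mA ord0) mB).
rewrite /= /lebesgue_cVS /pushforward; congr (_ _).
apply/seteqP; split=> [[a x] /= Aax|[a x] /= [Aa Ax] i].
  split; first by have := Aax ord0; rewrite mxE unlift_none.
  by move=> i; have := Aax (lift ord0 i); rewrite mxE liftK.
by rewrite mxE; case: (unliftP 0 i) => [j ->|->//]; exact: Ax.
Qed.

Definition dotp (R : realType) (d : nat) (x y : 'cV[R]_d) : R :=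
  \sum_(i < d) x i 0 * y i 0.

(* The library norm `|x| on matrices is the sup norm. *)
Definition enorm (R : realType) (d : nat) (x : 'cV[R]_d) : R :=
  Num.sqrt (dotp x x).

Definition eball (R : realType) (d : nat) (c : 'cV[R]_d) (r : R) :
    set 'cV[R]_d :=
  [set x | enorm (x - c) <= r].

Definition opnorm (R : realType) (d : nat) (A : 'M[R]_d) : R :=
  sup [set enorm (A *m x) | x in [set x : 'cV[R]_d | enorm x <= 1]].

Definition is_sym_sqrt (R : realType) (d : nat) (J F : 'M[R]_d) : Prop :=
  [/\ J^T = J, forall x : 'cV[R]_d, 0 <= dotp x (J *m x) & J *m J = F].

Definition gradient (R : realType) (d : nat) (g : 'cV[R]_d -> R)
    (t : 'cV[R]_d) : 'cV[R]_d :=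
  \col_i 'D_(delta_mx i 0) g t.

Definition hessian (R : realType) (d : nat) (g : 'cV[R]_d -> R)
    (t : 'cV[R]_d) : 'M[R]_d :=
  \matrix_(i, j) 'D_(delta_mx i 0) ('D_(delta_mx j 0) g) t.

Definition gauss_density (R : realType) (d : nat) (m : 'cV[R]_d)
    (V : 'M[R]_d) (u : 'cV[R]_d) : R :=
  expR (- (dotp (u - m) (invmx V *m (u - m)) / 2)) /
  Num.sqrt ((2 * pi) ^+ d * \det V).

Definition exp_density (R : realType) (d : nat) (h psi : 'cV[R]_d -> R)
    (t x : 'cV[R]_d) : R :=
  h x * expR (dotp x t - psi t).

(* Convexity of ef_psi on ef_Theta is a consequence of ef_normalized. *)
Record expfam (R : realType) (d : nat) := ExpFam {
  ef_Theta : set 'cV[R]_d;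
  ef_nu : {measure set 'cV[R]_d -> \bar R};
  ef_h : 'cV[R]_d -> R;
  ef_psi : 'cV[R]_d -> R;
  ef_open : open ef_Theta;
  ef_convex : convex_set ef_Theta;
  ef_h_ge0 : forall x, 0 <= ef_h x;
  ef_h_measurable : measurable_fun setT ef_h;
  ef_normalized : forall t, ef_Theta t ->
    (\int[ef_nu]_x (exp_density ef_h ef_psi t x)%:E = 1)%E
}.

Definition ef_density (R : realType) (d : nat) (M : expfam R d)
    (t x : 'cV[R]_d) : R :=
  exp_density (ef_h M) (ef_psi M) t x.

Definition ef_expect (R : realType) (d : nat) (M : expfam R d)
    (t : 'cV[R]_d) (g : 'cV[R]_d -> R) : \bar R :=
  (\int[ef_nu M]_x (g x * ef_density M t x)%:E)%E.

Definition ef_mean (R : realType) (d : nat) (M : expfam R d)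
    (t : 'cV[R]_d) : 'cV[R]_d :=
  \col_i fine (ef_expect M t (fun x => x i 0)).

Definition ef_mu (R : realType) (d : nat) (M : expfam R d) (t0 : 'cV[R]_d) :
  'cV[R]_d := gradient (ef_psi M) t0.

Definition ef_F (R : realType) (d : nat) (M : expfam R d) (t0 : 'cV[R]_d) :
  'M[R]_d := hessian (ef_psi M) t0.

Definition ef_V (R : realType) (d : nat) (M : expfam R d) (J : 'M[R]_d)
    (t x : 'cV[R]_d) : 'cV[R]_d :=
  invmx J *m (x - ef_mean M t).

Definition ef_ellipsoid (R : realType) (d : nat) (M : expfam R d)
    (t0 : 'cV[R]_d) (J : 'M[R]_d) (n : nat) (c : R) : set 'cV[R]_d :=
  [set t | ef_Theta M t /\ enorm (J *m (t - t0)) ^+ 2 <= c * d%:R / n%:R].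

(* B1, B2 and lambda are extended reals: the suprema need not be finite. *)
Definition B1 (R : realType) (d : nat) (M : expfam R d)
    (t0 : 'cV[R]_d) (J : 'M[R]_d) (n : nat) (c : R) : \bar R :=
  ereal_sup [set y | exists a t : 'cV[R]_d,
    [/\ enorm a = 1, ef_ellipsoid M t0 J n c t &
        y = `|ef_expect M t (fun x => (dotp a (ef_V M J t x) ^+ 3)%R)|%E]].

Definition B2 (R : realType) (d : nat) (M : expfam R d)
    (t0 : 'cV[R]_d) (J : 'M[R]_d) (n : nat) (c : R) : \bar R :=
  ereal_sup [set y | exists a t : 'cV[R]_d,
    [/\ enorm a = 1, ef_ellipsoid M t0 J n c t &
        y = ef_expect M t (fun x => dotp a (ef_V M J t x) ^+ 4)]].

Definition lambda (R : realType) (d : nat) (M : expfam R d)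
    (t0 : 'cV[R]_d) (J : 'M[R]_d) (n : nat) (c : R) : \bar R :=
  ((6^-1)%:E * ((Num.sqrt (c * d%:R / n%:R))%:E * B1 M t0 J n 0 +
                (c * d%:R / n%:R)%:E * B2 M t0 J n c))%E.

Definition local_space (R : realType) (d : nat) (M : expfam R d)
    (t0 : 'cV[R]_d) (J : 'M[R]_d) (n : nat) : set 'cV[R]_d :=
  [set Num.sqrt n%:R *: (J *m (t - t0)) | t in ef_Theta M].

Definition of_local (R : realType) (d : nat) (t0 : 'cV[R]_d) (J : 'M[R]_d)
    (n : nat) (u : 'cV[R]_d) : 'cV[R]_d :=
  t0 + (Num.sqrt n%:R)^-1 *: (invmx J *m u).

Definition Delta (R : realType) (d : nat) (M : expfam R d)
    (t0 : 'cV[R]_d) (J : 'M[R]_d) (n : nat) (x : 'I_n -> 'cV[R]_d) : 'cV[R]_d :=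
  Num.sqrt n%:R *: (invmx J *m (n%:R^-1 *: (\sum_(i < n) x i) - ef_mu M t0)).

Definition post_weight (R : realType) (d : nat) (M : expfam R d)
    (prior : 'cV[R]_d -> R) (t0 : 'cV[R]_d) (J : 'M[R]_d) (n : nat)
    (x : 'I_n -> 'cV[R]_d) (u : 'cV[R]_d) : R :=
  prior (of_local t0 J n u) * \prod_(i < n) ef_density M (of_local t0 J n u) (x i).

Definition local_posterior (R : realType) (d : nat) (M : expfam R d)
    (prior : 'cV[R]_d -> R) (t0 : 'cV[R]_d) (J : 'M[R]_d) (n : nat)
    (x : 'I_n -> 'cV[R]_d) (u : 'cV[R]_d) : R :=
  post_weight M prior t0 J x u /
  \int[lebesgue_cV R d]_(v in local_space M t0 J n) post_weight M prior t0 J x v.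

(* A prior density on ef_Theta, possibly improper. *)
Definition is_prior (R : realType) (d : nat) (M : expfam R d)
    (prior : 'cV[R]_d -> R) : Prop :=
  measurable_fun (ef_Theta M) prior /\
  (forall t, ef_Theta M t -> 0 <= prior t).

Definition prior_radius (R : realType) (d : nat) (M : expfam R d)
    (t0 : 'cV[R]_d) (n : nat) (c : R) : R :=
  Num.sqrt (c * opnorm (invmx (ef_F M t0)) * d%:R / n%:R).

(* lne is the logarithm with lne 0 = -oo, so that priors vanishing somewhere on
   ef_Theta are allowed. *)
Definition assumption_P (R : realType) (d : nat -> nat)
    (M : forall n, expfam R (d n)) (t0 : forall n, 'cV[R]_(d n))
    (prior : forall n, 'cV[R]_(d n) -> R) (c : nat -> R) : Prop :=
  [/\ forall n, 0 < prior n (t0 n),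
      exists C : R, \forall n \near \oo,
        (ereal_sup [set lne (prior n t / prior n (t0 n))%:E
                   | t in ef_Theta (M n)] <= (C * (d n)%:R)%:E)%E &
      exists K : nat -> R,
        (forall n t, ef_Theta (M n) t ->
           enorm (t - t0 n) <= prior_radius (M n) (t0 n) n (c n) ->
           (`|lne (prior n t)%:E - lne (prior n (t0 n))%:E| <=
            (K n * enorm (t - t0 n))%:E)%E) /\
        K n * prior_radius (M n) (t0 n) n (c n) @[n --> \oo] --> 0].

Definition mutually_independent (disp : measure_display)
    (Omega : measurableType disp) (R : realType) (P : probability Omega R)
    (d n : nat) (X : 'I_n -> {RV P >-> 'cV[R]_d}) : Prop :=
  forall (I : {set 'I_n}) (A : 'I_n -> set 'cV[R]_d),
    (forall i, measurable (A i)) ->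
    P (\bigcap_(i in [set i | i \in I]) X i @^-1` A i) =
    (\prod_(i in I) P (X i @^-1` A i))%E.

Definition has_density (disp : measure_display)
    (Omega : measurableType disp) (R : realType) (P : probability Omega R)
    (d : nat) (X : {RV P >-> 'cV[R]_d}) (M : expfam R d) (t : 'cV[R]_d) : Prop :=
  forall A, measurable A ->
    distribution P X A = (\int[ef_nu M]_(x in A) (ef_density M t x)%:E)%E.

Definition is_op1 (disp : nat -> measure_display)
    (Omega : forall n, measurableType (disp n)) (R : realType)
    (P : forall n, probability (Omega n) R)
    (Y : forall n, Omega n -> \bar R) : Prop :=
  forall eps : R, 0 < eps ->
    P n [set w | (eps%:E < `|Y n w|)%E] @[n --> \oo] --> 0%E.

(* Main.v *)
Require Import Defs.
From HB Require Import structures.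
From mathcomp Require Import all_boot all_order all_algebra.
From mathcomp Require Import all_classical all_reals all_analysis.
From mathcomp Require Import measurable_realfun ring lra.

Set Implicit Arguments.
Unset Strict Implicit.
Unset Printing Implicit Defensive.

Import Order.TTheory GRing.Theory Num.Theory.
Import numFieldNormedType.Exports.

Local Open Scope classical_set_scope.
Local Open Scope ring_scope.

(* With [psi] the log-normalizer and [theta u = theta0 + n^(-1/2) J^-1 u], the
   log-likelihood ratio at [u] is
     <Delta, u> - n (psi (theta u) - psi theta0 - <mu, theta u - theta0>).
   On the ball [|u|^2 <= c d], a fourth-order Taylor expansion of [psi] along
   the segment, whose third and fourth derivatives are cumulants of [<v, X>],
   shows that it differs from [<Delta, u> - |u|^2 / 2] by at most
   [lambda(c) |u|^2 = o(1)], and the prior ratio is [1 + o(1)] there.  Outside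
   the ball the log-likelihood ratio is concave, so its value on the sphere of
   radius [(c d)^(1/2)] gives the bound [- (c d)^(1/2) |u| / 4] as soon as
   [|Delta|^2 <= K d] with [64 K <= c]; the corresponding exponential integral
   beats the factor [exp (C d)] allowed for the prior when [c] is large.
   Finally [E |Delta|^2 = d], so that [|Delta|^2 <= K d] has probability at
   least [1 - 1/K] by Markov's inequality. *)

(** * Euclidean geometry *)

(** The hypotheses hold for each fixed [c], and the order of choices exploits this: the allowed
    failure probability [delta] fixes [K], then [c] is taken above multiples of [K] and of the
    constant [C] of the prior bound, and only then does [n] grow. This is not circular because [c]
    does not occur in the clause of [assumption_P] that provides [C]. The comparison is made before
    normalisation: a rescaled posterior weight [f] is within [eta] of the Gaussian density in L1, so
    its integral is within [eta] of 1, and dividing by it costs at most another [eta]. The tail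
    integral avoids polar coordinates: it is bounded by [expR (- (c * d / 8))] times that of a
    product of Cauchy functions, whose mass [pi ^ d] is only exponential in [d]. The factor [sqrt d]
    lost between the Euclidean and the l1 norm is absorbed by the radius [sqrt (c * d)]. Regularity
    of [psi] is derived from [ef_normalized]: openness of the parameter set gives exponential
    moments, and these give the derivatives and their moment formulas. *)

Section Euclidean.
Variables (R : realType) (d : nat).
Implicit Types (x y z : 'cV[R]_d) (A : 'M[R]_d) (k : R).

Lemma dotpC x y : dotp x y = dotp y x.
Proof. by apply: eq_bigr => i _; rewrite mulrC. Qed.

Lemma dotpDr x y z : dotp x (y + z) = dotp x y + dotp x z.
Proof. by rewrite -big_split; apply: eq_bigr => i _; rewrite mxE mulrDr. Qed.

Lemma dotpDl x y z : dotp (y + z) x = dotp y x + dotp z x.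
Proof. by rewrite dotpC dotpDr !(dotpC x). Qed.

Lemma dotpZr k x y : dotp x (k *: y) = k * dotp x y.
Proof. by rewrite mulr_sumr; apply: eq_bigr => i _; rewrite mxE mulrCA. Qed.

Lemma dotpZl k x y : dotp (k *: x) y = k * dotp x y.
Proof. by rewrite dotpC dotpZr dotpC. Qed.

Lemma dotpNr x y : dotp x (- y) = - dotp x y.
Proof. by rewrite -scaleN1r dotpZr mulN1r. Qed.

Lemma dotpNl x y : dotp (- x) y = - dotp x y.
Proof. by rewrite dotpC dotpNr dotpC. Qed.

Lemma dotpBr x y z : dotp x (y - z) = dotp x y - dotp x z.
Proof. by rewrite dotpDr dotpNr. Qed.

Lemma dotpBl x y z : dotp (y - z) x = dotp y x - dotp z x.
Proof. by rewrite dotpDl dotpNl. Qed.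

Lemma dotp0r x : dotp x 0 = 0.
Proof. by rewrite -(scale0r 0) dotpZr mul0r. Qed.

Lemma dotp0l x : dotp 0 x = 0.
Proof. by rewrite dotpC dotp0r. Qed.

Lemma dotp_sumr (I : Type) (s : seq I) x (F : I -> 'cV[R]_d) :
  dotp x (\sum_(i <- s) F i) = \sum_(i <- s) dotp x (F i).
Proof.
by elim/big_ind2 : _ => [|a b a' b' <- <-|//]; rewrite ?dotp0r ?dotpDr.
Qed.

Lemma dotp_mulmxr A x y : dotp x (A *m y) = dotp (A^T *m x) y.
Proof.
have E a b : dotp a b = (a^T *m b : 'M[R]_1) 0 0.
  by rewrite mxE; apply: eq_bigr => i _; rewrite mxE.
by rewrite !E trmx_mul trmxK mulmxA.
Qed.

Lemma dotp_delta i x : dotp (delta_mx i 0) x = x i 0.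
Proof.
rewrite /dotp (bigD1 i)//= mxE !eqxx mul1r big1 ?addr0// => j ji.
by rewrite mxE (negbTE ji) mul0r.
Qed.

Lemma dotp_ge0 x : 0 <= dotp x x.
Proof. by apply: sumr_ge0 => i _; rewrite -expr2 sqr_ge0. Qed.

Lemma enorm_ge0 x : 0 <= enorm x.
Proof. exact: sqrtr_ge0. Qed.

Lemma sqr_enorm x : enorm x ^+ 2 = dotp x x.
Proof. by rewrite sqr_sqrtr// dotp_ge0. Qed.

Lemma enormZ k x : enorm (k *: x) = `|k| * enorm x.
Proof.
by rewrite /enorm dotpZl dotpZr mulrA -expr2 sqrtrM ?sqr_ge0// sqrtr_sqr.
Qed.

Lemma enorm_eq0 x : enorm x = 0 -> x = 0.
Proof.
move=> /(congr1 (fun r => r ^+ 2)); rewrite sqr_enorm expr0n/= => /eqP.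
rewrite psumr_eq0 => [/allP x0|i _]; last by rewrite -expr2 sqr_ge0.
apply/matrixP => i j; rewrite ord1 mxE.
by have := x0 i (mem_index_enum _); rewrite -expr2 sqrf_eq0 => /eqP.
Qed.

(** Cauchy-Schwarz, by expanding the squared length of [enorm y *: x - enorm x *: y]. *)
Lemma dotp_le_enorm x y : dotp x y <= enorm x * enorm y.
Proof.
have [/enorm_eq0 ->|x0] := eqVneq (enorm x) 0.
  by rewrite dotp0l mulr_ge0// enorm_ge0.
have [/enorm_eq0 ->|y0] := eqVneq (enorm y) 0.
  by rewrite dotp0r mulr_ge0// enorm_ge0.
have x_gt0 : 0 < enorm x by rewrite lt_neqAle eq_sym x0 enorm_ge0.
have y_gt0 : 0 < enorm y by rewrite lt_neqAle eq_sym y0 enorm_ge0.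
have := dotp_ge0 (enorm y *: x - enorm x *: y).
rewrite !(dotpBl, dotpBr, dotpZl, dotpZr) -!sqr_enorm (dotpC y x) => H.
rewrite -(ler_pM2l (mulr_gt0 x_gt0 y_gt0)); nra.
Qed.

Lemma normr_dotp x y : `|dotp x y| <= enorm x * enorm y.
Proof.
rewrite ler_norml dotp_le_enorm andbT -[leRHS]opprK lerN2 -dotpNl.
by rewrite (le_trans (dotp_le_enorm _ _))// -scaleN1r enormZ normrN1 mul1r.
Qed.

(** The auxiliary norm for domination arguments: its exponential factorises over the coordinates,
    and it is dual to the sup norm that defines the topology. *)
Definition l1norm x : R := \sum_i `|x i 0|.

Lemma l1norm_ge0 x : 0 <= l1norm x.
Proof. by apply: sumr_ge0. Qed.

Lemma normr_coord_l1norm x i : `|x i 0| <= l1norm x.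
Proof. by rewrite /l1norm (bigD1 i)//= lerDl sumr_ge0. Qed.

Lemma normr_dotp_l1norm x y : `|dotp x y| <= l1norm y * l1norm x.
Proof.
rewrite (le_trans (ler_norm_sum _ _ _))// mulr_sumr ler_sum// => i _.
by rewrite normrM mulrC ler_wpM2r// normr_coord_l1norm.
Qed.

Lemma l1norm_le_enorm x : l1norm x <= Num.sqrt d%:R * enorm x.
Proof.
have -> : l1norm x = dotp (\col_i `|x i 0|) (\col_i 1).
  by apply: eq_bigr => i _; rewrite !mxE mulr1.
rewrite (le_trans (dotp_le_enorm _ _))// mulrC le_eqVlt; apply/orP; left.
apply/eqP; congr (Num.sqrt _ * Num.sqrt _).
- by rewrite /dotp (eq_bigr (fun=> 1)) ?sumr_const ?card_ord// => i _; rewrite !mxE mulr1.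
- by apply: eq_bigr => i _; rewrite !mxE -!expr2 real_normK ?num_real.
Qed.

Lemma coord_le_enorm x i : `|x i 0| <= enorm x.
Proof.
rewrite -dotp_delta (le_trans (normr_dotp _ _))//.
suff -> : enorm (delta_mx i 0 : 'cV[R]_d) = 1 by rewrite mul1r.
by rewrite /enorm dotp_delta mxE !eqxx sqrtr1.
Qed.

Lemma enorm_le_l1norm x : enorm x <= l1norm x.
Proof.
rewrite -(@ler_pXn2r _ 2) ?nnegrE ?enorm_ge0 ?l1norm_ge0// sqr_enorm expr2.
exact: le_trans (ler_norm _) (normr_dotp_l1norm _ _).
Qed.

Lemma enorm_mulmx A x : enorm (A *m x) <= opnorm A * enorm x.
Proof.
(* [opnorm] is a real [sup], an upper bound only once the set is known to be bounded; the sum of all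
   absolute entries bounds it. *)
have bnd : has_sup [set enorm (A *m z) | z in [set z : 'cV[R]_d | enorm z <= 1]].
  split.
    by exists (enorm (A *m 0)), 0 => //=; rewrite /enorm dotp0r sqrtr0.
  exists (\sum_i \sum_j `|A i j|) => _ [z z1 <-].
  apply: (le_trans (enorm_le_l1norm _)); apply: ler_sum => i _.
  rewrite mxE (le_trans (ler_norm_sum _ _ _))//; apply: ler_sum => j _.
  by rewrite normrM ler_piMr// (le_trans (coord_le_enorm _ _)).
have [/enorm_eq0 ->|x0] := eqVneq (enorm x) 0.
  by rewrite mulmx0 /enorm dotp0r sqrtr0 mulr0.
have x_gt0 : 0 < enorm x by rewrite lt_neqAle eq_sym x0 enorm_ge0.
rewrite -ler_pdivrMr//; apply: ub_le_sup; first by case: bnd.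
exists ((enorm x)^-1 *: x).
  by rewrite /= enormZ ger0_norm ?invr_ge0 ?enorm_ge0// mulVf.
by rewrite -scalemxAr enormZ ger0_norm ?invr_ge0 ?enorm_ge0// mulrC.
Qed.

End Euclidean.

(** * Open sets and the coordinate sigma-algebra *)

Section Borel.
Variables (R : realType) (d : nat).

(* Rational boxes form a countable base of the sup-norm topology. *)
Lemma open_cV_measurable (A : set 'cV[R]_d) : open A -> measurable A.
Proof.
move=> oA.
pose box (q : 'cV[rat]_d * nat) : set 'cV[R]_d :=
  [set x | forall i, ball (ratr (q.1 i 0) : R) q.2.+1%:R^-1 (x i 0)].
pose B (k : nat) : set 'cV[R]_d :=
  if unpickle k is Some q then (if `[< box q `<=` A >] then box q else set0)
  else set0.
suff -> : A = \bigcup_k B k.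
  apply: bigcupT_measurable => k; rewrite /B; case: unpickle => // q.
  case: ifPn => // _; apply: (@measurable_cV_box R d
    (fun i => ball (ratr (q.1 i 0) : R) q.2.+1%:R^-1)) => i.
  exact: measurable_ball.
apply/seteqP; split=> [x Ax|x [k _]]; last first.
  by rewrite /B; case: unpickle => // q; case: ifPn => // /asboolP; exact.
have [e /= e0 xeA] : nbhs_ball x A by apply/nbhs_ballP; exact: oA.
pose k := Num.bound (2 / e)%R.
have ke : k.+1%:R^-1 + k.+1%:R^-1 < e :> R.
  have kp : 0 < k.+1%:R :> R by rewrite ltr0n.
  rewrite (_ : _ + _ = 2 / k.+1%:R); last by ring.
  rewrite ltr_pdivrMr// mulrC -ltr_pdivrMr//.
  by rewrite (lt_trans (archi_boundP _)) ?divr_ge0 ?ltW// ltr_nat.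
have kp : 0 < k.+1%:R^-1 :> R by rewrite invr_gt0 ltr0n.
have /choice[q qP] : forall i : 'I_d,
    exists q : rat, ball (ratr q : R) k.+1%:R^-1 (x i 0).
  move=> i; have := @dense_rat R (ball (x i 0) k.+1%:R^-1).
  case.
  - by exists (x i 0); exact: ballxx.
  - exact: ball_open.
  - by move=> r [br [q _ qr]]; exists q; rewrite qr; exact: ball_sym.
exists (pickle ((\col_i q i, k) : 'cV[rat]_d * nat)) => //.
rewrite /B pickleK; case: ifPn => [_ i|/asboolP []]; first by rewrite mxE.
move=> y yq; apply: xeA; split => // i j; rewrite (ord1 j).
have xq := ball_sym (qP i).
have qy : ball (ratr (q i) : R) k.+1%:R^-1 (y i 0) by have := yq i; rewrite /= mxE.
exact: (le_ball (ltW ke) (ball_triangle xq qy)).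
Qed.

End Borel.

(** * Exponential moments *)

Lemma expR_ge1 (R : realType) (x : R) : 0 <= x -> 1 <= expR x.
Proof. by move=> x0; rewrite -expR0 ler_expR. Qed.

Lemma normr_expR_sub1 (R : realType) (s : R) :
  `|expR s - 1| <= `|s| * expR `|s|.
Proof.
have e1 := expR_ge1Dx (- s); have e2 := expR_ge1Dx s.
have es : expR s - 1 <= s * expR s.
  by have := ler_wpM2r (expR_ge0 s) e1; rewrite expRN mulVf ?gt_eqF ?expR_gt0//; lra.
have [s0|s0] := leP 0 s.
  by rewrite !ger0_norm//; lra.
have e3 : 1 <= expR `|s| by rewrite expR_ge1.
rewrite ler0_norm; last by rewrite subr_le0 expR_le1 ltW.
apply: (@le_trans _ _ `|s|); last by rewrite ler_peMr.
by rewrite ltr0_norm//; lra.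
Qed.

Lemma normr_expR_taylor1 (R : realType) (s : R) :
  `|expR s - 1 - s| <= s ^+ 2 * expR `|s|.
Proof.
have e1 := expR_ge1Dx (- s); have e2 := expR_ge1Dx s.
have es : expR s - 1 <= s * expR s.
  by have := ler_wpM2r (expR_ge0 s) e1; rewrite expRN mulVf ?gt_eqF ?expR_gt0//; lra.
rewrite ger0_norm; last by lra.
(* Subtracting [s] from both sides of [es] gives this intermediate bound. *)
apply: (@le_trans _ _ (s * (expR s - 1))); first by lra.
apply: (le_trans (ler_norm _)); rewrite normrM expr2 -[s * s]ger0_norm -?expr2 ?sqr_ge0//.
by rewrite expr2 normrM -mulrA ler_wpM2l// normr_expR_sub1.
Qed.

Section MeasurableCoordinates.
Variables (R : realType) (d : nat).

Lemma measurable_dotp (disp : measure_display) (T : measurableType disp)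
    (D : set T) (f g : T -> 'cV[R]_d) :
  (forall i, measurable_fun D (fun x => f x i 0)) ->
  (forall i, measurable_fun D (fun x => g x i 0)) ->
  measurable_fun D (fun x => dotp (f x) (g x)).
Proof. by move=> mf mg; apply: measurable_sum => i; exact: measurable_funM. Qed.

Lemma measurable_dotpl (v : 'cV[R]_d) : measurable_fun setT (fun x => dotp x v).
Proof. by apply: measurable_dotp => i //; exact: measurable_cV_coord. Qed.

Lemma measurable_l1norm : measurable_fun setT (@l1norm R d).
Proof.
apply: measurable_sum => i; apply: measurableT_comp => //.
exact: measurable_cV_coord.
Qed.

End MeasurableCoordinates.

(** * Functions of subexponential growth *)

Section Subexponential.
Variables (R : realType) (d : nat).
Implicit Types p q : 'cV[R]_d -> R.

(** A class of integrands closed under sums and products and containing all polynomials. Since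
    [Theta] is open, the model has some exponential moment at each parameter, which dominates every
    such function; one class therefore serves integrability and differentiation alike. *)
Definition subexp p : Prop := measurable_fun setT p /\
  forall e : R, 0 < e ->
  exists2 C : R, 0 <= C & forall x, `|p x| <= C * expR (e * l1norm x).

Lemma subexp_cst k : subexp (fun=> k).
Proof.
split=> // e e0; exists `|k| => // x.
by rewrite ler_peMr// expR_ge1// mulr_ge0 ?l1norm_ge0 ?(ltW e0).
Qed.

Lemma subexp_dotp v : subexp (fun x => dotp x v).
Proof.
split=> [|e e0]; first exact: measurable_dotpl.
exists (l1norm v / e) => [|x]; first by rewrite divr_ge0 ?l1norm_ge0 ?ltW.
apply: (le_trans (normr_dotp_l1norm _ _)).
rewrite -mulrA ler_wpM2l ?l1norm_ge0// mulrC ler_pdivlMr// mulrC.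
by apply: le_trans (expR_ge1Dx _); rewrite lerDr.
Qed.

Lemma subexpD p q : subexp p -> subexp q -> subexp (fun x => p x + q x).
Proof.
move=> [mp sp] [mq sq]; split=> [|e e0]; first exact: measurable_funD.
have [C C0 pC] := sp _ e0; have [C' C'0 qC'] := sq _ e0.
exists (C + C') => [|x]; first exact: addr_ge0.
by rewrite mulrDl (le_trans (ler_normD _ _))// lerD.
Qed.

Lemma subexpM p q : subexp p -> subexp q -> subexp (fun x => p x * q x).
Proof.
move=> [mp sp] [mq sq]; split=> [|e e0]; first exact: measurable_funM.
have e20 : 0 < e / 2 by rewrite divr_gt0.
have [C C0 pC] := sp _ e20; have [C' C'0 qC'] := sq _ e20.
exists (C * C') => [|x]; first exact: mulr_ge0.
rewrite [e in leRHS]splitr mulrDl expRD normrM mulrACA.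
exact: ler_pM.
Qed.

Lemma subexpX p n : subexp p -> subexp (fun x => p x ^+ n).
Proof.
move=> sp; elim: n => [|n ih]; first exact: subexp_cst.
by under eq_fun do rewrite exprS; exact: subexpM.
Qed.

Lemma subexp_dotpB v k : subexp (fun x => dotp x v - k).
Proof. by apply: subexpD; [exact: subexp_dotp|exact: subexp_cst]. Qed.

Lemma subexp_l1norm : subexp (@l1norm R d).
Proof.
split=> [|e e0]; first exact: measurable_l1norm.
exists e^-1 => [|x]; first by rewrite invr_ge0 ltW.
rewrite ger0_norm ?l1norm_ge0// mulrC ler_pdivlMr// mulrC.
by apply: le_trans (expR_ge1Dx _); rewrite lerDr.
Qed.

End Subexponential.

(** * Moments against the exponential weight *)

Section Weight.
Variables (R : realType) (d : nat) (M : expfam R d).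
Local Notation nu := (ef_nu M).
Local Notation Theta := (ef_Theta M).
Local Notation psi := (ef_psi M).
Implicit Types (t v x : 'cV[R]_d) (p q : 'cV[R]_d -> R).

(* Locked, so that rewriting with ring identities does not look inside. *)
Definition ef_weight t x : R := locked (ef_h M x * expR (dotp x t)).

Lemma ef_weightE t x : ef_weight t x = ef_h M x * expR (dotp x t).
Proof. by rewrite /ef_weight -lock. Qed.

Lemma ef_densityE t x : ef_density M t x = expR (- psi t) * ef_weight t x.
Proof. by rewrite ef_weightE /ef_density /exp_density expRD mulrA mulrC. Qed.

Lemma ef_weight_ge0 t x : 0 <= ef_weight t x.
Proof. by rewrite ef_weightE mulr_ge0 ?ef_h_ge0 ?expR_ge0. Qed.

Lemma ef_weightD t v x : ef_weight (t + v) x = ef_weight t x * expR (dotp x v).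
Proof. by rewrite !ef_weightE dotpDr expRD mulrA. Qed.

Lemma measurable_ef_weight t : measurable_fun setT (ef_weight t).
Proof.
rewrite (_ : ef_weight t = fun x => ef_h M x * expR (dotp x t)); last first.
  by apply/funext => x; rewrite ef_weightE.
apply: measurable_funM; first exact: ef_h_measurable.
by apply: measurableT_comp => //; exact: measurable_dotpl.
Qed.

Lemma integral_ef_weight t : Theta t ->
  (\int[nu]_x (ef_weight t x)%:E)%E = (expR (psi t))%:E.
Proof.
move=> tT; have := ef_normalized tT.
under eq_integral do rewrite -/(ef_density M t _) ef_densityE EFinM.
rewrite ge0_integralZl_EFin ?expR_ge0//.
- move=> /(congr1 (fun y => (expR (psi t))%:E * y))%E.
  by rewrite muleA -EFinM -expRD subrr expR0 mul1e mule1.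
- by move=> x _; rewrite lee_fin ef_weight_ge0.
- by apply/measurable_EFinP; exact: measurable_ef_weight.
Qed.

Lemma integrable_ef_weight t : Theta t ->
  nu.-integrable setT (EFin \o ef_weight t).
Proof.
move=> tT; apply/integrableP; split.
  by apply/measurable_EFinP; exact: measurable_ef_weight.
under eq_integral do rewrite /= ger0_norm ?ef_weight_ge0//.
by rewrite integral_ef_weight// ltry.
Qed.

Lemma ef_Theta_l1ball t : Theta t ->
  exists2 r : R, 0 < r & forall v, l1norm v <= r -> Theta (t + v).
Proof.
move=> tT; have [e /= e0 te] : nbhs_ball t Theta.
  by apply/nbhs_ballP; exact: (@ef_open _ _ M).
(* The sup norm is at most [l1norm]; halving the radius gives the strict inequality demanded by
   [ball]. *)
exists (e / 2) => [|v vr]; first by rewrite divr_gt0.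
apply: te; split=> // i j; rewrite (ord1 j) mxE /ball /= opprD addNKr normrN.
rewrite (le_lt_trans (normr_coord_l1norm _ _))// (le_lt_trans vr)//.
by rewrite ltr_pdivrMr// ltr_pMr// ltr1n.
Qed.

Lemma l1norm_delta i (k : R) : l1norm (k *: delta_mx i 0 : 'cV[R]_d) = `|k|.
Proof.
rewrite /l1norm (bigD1 i)//= !mxE !eqxx mulr1 big1 ?addr0// => j ji.
by rewrite !mxE (negbTE ji) mulr0 normr0.
Qed.

(** Some coordinate satisfies [l1norm x <= d * |x i|], so one exponential along that axis suffices.
    The right-hand side involves only exponentials of linear forms, which act on [ef_weight] as
    shifts of the parameter. *)
Lemma expR_l1norm_le (e : R) x : 0 <= e ->
  expR (e * l1norm x) <= 1 + \sum_(i < d)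
    (expR ((d%:R * e) * x i 0) + expR (- (d%:R * e) * x i 0)).
Proof.
move=> e0.
have S0 (P : pred 'I_d) : 0 <= \sum_(i < d | P i)
    (expR ((d%:R * e) * x i 0) + expR (- (d%:R * e) * x i 0)).
  by apply: sumr_ge0 => i _; rewrite addr_ge0// expR_ge0.
have [x0|/forallPn[i lei]] := boolP [forall i, d%:R * `|x i 0| < l1norm x]; last first.
  rewrite -leNgt in lei.
  apply: (@le_trans _ _ (expR (d%:R * e * `|x i 0|))).
    by rewrite ler_expR -mulrA mulrCA ler_wpM2l.
  rewrite (bigD1 i)//= addrCA -[leLHS]addr0 lerD ?addr_ge0//.
  have [xi|xi] := ger0P (x i 0); first by rewrite lerDl expR_ge0.
  by rewrite mulrN mulNr lerDr expR_ge0.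
(* Only [d = 0] survives here, and it is what the summand 1 is for: with [d > 0], summing the strict
   inequalities gives [l1norm x * d < l1norm x * d]. *)
suff -> : l1norm x = 0 by rewrite mulr0 expR0 lerDl S0.
have [d0|d0] := posnP d.
  by rewrite /l1norm big1// => i; have := ltn_ord i; rewrite {2}d0.
have : \sum_(i < d) d%:R * `|x i 0| < \sum_(i < d) l1norm x.
  apply: ltr_sum => [|i _]; last exact: (forallP x0).
  by apply/hasP; exists (Ordinal d0) => //; rewrite mem_index_enum.
by rewrite -mulr_sumr -/(l1norm x) sumr_const card_ord mulr_natl ltxx.
Qed.

Lemma integrable_expR_l1norm t : Theta t -> exists2 e : R, 0 < e &
  nu.-integrable setT (fun x => (expR (e * l1norm x) * ef_weight t x)%:E).
Proof.
move=> tT; have [r r0 tr] := ef_Theta_l1ball tT.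
have dr0 : 0 < d%:R + 1 :> R by rewrite ltr_wpDl.
(* With this [e] the shifts by [d * e] along the axes stay in [Theta]; the [+ 1] keeps the
   denominator positive when [d = 0]. *)
pose e := r / (d%:R + 1); have e0 : 0 < e by rewrite divr_gt0.
have der : `|d%:R * e| <= r.
  rewrite ger0_norm; last by rewrite mulr_ge0// ltW.
  by rewrite /e mulrA ler_pdivrMr// mulrC ler_wpM2l ?lerDl// ltW.
exists e => //.
pose g x := ef_weight t x + \sum_(i < d)
  (ef_weight (t + (d%:R * e) *: delta_mx i 0) x +
   ef_weight (t + (- (d%:R * e)) *: delta_mx i 0) x).
apply: (@le_integrable _ _ _ _ _ _ _ (EFin \o g)) => //.
- apply/measurable_EFinP/measurable_funM; last exact: measurable_ef_weight.
  apply: measurableT_comp => //; apply: measurable_funM => //.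
  exact: measurable_l1norm.
- move=> x _; rewrite /= !lee_fin ger0_norm; last first.
    by rewrite mulr_ge0 ?expR_ge0 ?ef_weight_ge0.
  apply: le_trans (ler_norm _).
  rewrite mulrC; apply: (le_trans (ler_wpM2l (ef_weight_ge0 _ _) (expR_l1norm_le _ (ltW e0)))).
  rewrite /g mulrDr mulr1 lerD2l mulr_sumr ler_sum// => i _.
  by rewrite mulrDr !ef_weightD !dotpZr dotpC dotp_delta.
- pose wp i := ef_weight (t + (d%:R * e) *: delta_mx i 0).
  pose wm i := ef_weight (t + (- (d%:R * e)) *: delta_mx i 0).
  rewrite (_ : EFin \o g = ((EFin \o ef_weight t) \+ (fun x => (\sum_(i < d)
    ((EFin \o wp i) \+ (EFin \o wm i)) x)%E))%E); last first.
    by apply/funext => x; rewrite /= /g EFinD -sumEFin.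
  apply: integrableD => //; first exact: integrable_ef_weight.
  apply: integrable_sum => // i _; apply: integrableD => //;
    by apply/integrable_ef_weight/tr; rewrite l1norm_delta ?normrN.
Qed.

Lemma integrable_subexp t p : Theta t -> subexp p ->
  nu.-integrable setT (fun x => (p x * ef_weight t x)%:E).
Proof.
move=> tT [mp sp]; have [e e0 ie] := integrable_expR_l1norm tT.
have [C C0 pC] := sp _ e0.
apply: (@le_integrable _ _ _ _ _ _ _
  (fun x => C%:E * (expR (e * l1norm x) * ef_weight t x)%:E)%E) => //.
- by apply/measurable_EFinP/measurable_funM => //; exact: measurable_ef_weight.
- move=> x _; rewrite -EFinM /= lee_fin mulrA !(normrM _ (ef_weight t x)).
  by rewrite ler_wpM2r// (le_trans (pC x))// ler_norm.
- exact: integrableZl.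
Qed.

(** Leaving out [expR (- psi t)] makes the dependence on [t] purely exponential; the normalisation
    returns as the moment of 1. *)
Definition moment p t : R := \int[nu]_x (p x * ef_weight t x).

Lemma momentD p q t : Theta t -> subexp p -> subexp q ->
  moment (fun x => p x + q x) t = moment p t + moment q t.
Proof.
move=> tT sp sq; rewrite /moment.
under eq_Rintegral do rewrite mulrDl.
by rewrite RintegralD//; exact: integrable_subexp.
Qed.

Lemma momentZ k p t : Theta t -> subexp p ->
  moment (fun x => k * p x) t = k * moment p t.
Proof.
move=> tT sp; rewrite /moment.
under eq_Rintegral do rewrite -mulrA.
by rewrite RintegralZl//; exact: integrable_subexp.
Qed.

Lemma eq_moment p q t : p =1 q -> moment p t = moment q t.
Proof. by move=> /funext ->. Qed.

Lemma moment1 t : Theta t -> moment (fun=> 1) t = expR (psi t).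
Proof.
move=> tT; rewrite /moment; under eq_Rintegral do rewrite mul1r.
by rewrite /Rintegral integral_ef_weight.
Qed.

(* Quadratic remainder: [exp s - 1 - s] is dominated by [s^2 exp |s|], and the
   exponential moment of [integrable_expR_l1norm] absorbs everything. *)
Lemma moment_expansion t p : Theta t -> subexp p ->
  exists2 r : R, 0 < r & exists2 C : R, 0 <= C & forall v, l1norm v <= r ->
    Theta (t + v) /\
    `|moment p (t + v) - moment p t - moment (fun x => p x * dotp x v) t|
      <= C * l1norm v ^+ 2.
Proof.
move=> tT sp; have [r1 r10 tr] := ef_Theta_l1ball tT.
have [e e0 ie] := integrable_expR_l1norm tT.
have e20 : 0 < e / 2 by rewrite divr_gt0.
(* Half of the rate [e] pays for [p x * l1norm x ^+ 2], the other half for [expR |dotp x v|]; hence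
   the restriction [l1norm v <= e / 2] below. *)
have [_ /(_ _ e20) [C C0 pC]] := subexpM sp (subexpX 2 (subexp_l1norm R d)).
exists (Num.min r1 (e / 2)); first by rewrite lt_min r10.
exists (C * \int[nu]_x (expR (e * l1norm x) * ef_weight t x)).
  rewrite mulr_ge0// Rintegral_ge0// => x _.
  by apply: mulr_ge0; rewrite ?expR_ge0 ?ef_weight_ge0.
move=> v; rewrite le_min => /andP[vr1 ve]; have tvT := tr _ vr1; split=> //.
have spv : subexp (fun x => p x * dotp x v) by apply: subexpM => //; exact: subexp_dotp.
have i1 := integrable_subexp tvT sp; have i2 := integrable_subexp tT sp.
have i12 := integrableB measurableT i1 i2.
have i123 := integrableB measurableT i12 (integrable_subexp tT spv).
rewrite /moment -RintegralB// -RintegralB//; last exact: integrable_subexp.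
apply: (le_trans (le_normr_Rintegral _ _)) => //.
rewrite mulrAC -RintegralZl//; apply: le_Rintegral => //.
- by have /integrable_abse := i123; apply: eq_integrable.
- by apply: eq_integrable (integrableZl measurableT (C * l1norm v ^+ 2) ie).
- move=> x _; rewrite ef_weightD.
  have -> : p x * (ef_weight t x * expR (dotp x v)) - p x * ef_weight t x -
    p x * dotp x v * ef_weight t x =
    p x * (expR (dotp x v) - 1 - dotp x v) * ef_weight t x by ring.
  rewrite normrM (ger0_norm (ef_weight_ge0 _ _)) mulrA ler_wpM2r ?ef_weight_ge0//.
  rewrite normrM; apply: (le_trans (ler_wpM2l (normr_ge0 _) (normr_expR_taylor1 _))).
  have xv := normr_dotp_l1norm x v.
  rewrite {1}(splitr e) mulrDl expRD mulrA.
  have H : `|p x| * dotp x v ^+ 2 <= C * l1norm v ^+ 2 * expR (e / 2 * l1norm x).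
    have := pC x; rewrite normrM normrX (ger0_norm (l1norm_ge0 x)) => pCx.
    apply: (@le_trans _ _ (`|p x| * (l1norm v * l1norm x) ^+ 2)).
      by rewrite ler_wpM2l// -real_normK ?num_real// ler_pXn2r ?nnegrE ?mulr_ge0 ?l1norm_ge0.
    by rewrite exprMn mulrCA [leRHS]mulrAC [leRHS]mulrC ler_wpM2l// exprn_ge0// l1norm_ge0.
  rewrite mulrA; apply: ler_pM => //; first by rewrite mulr_ge0// sqr_ge0.
  by rewrite ler_expR (le_trans xv)// ler_wpM2r// l1norm_ge0.
Qed.

End Weight.

(** * Taylor expansion on a segment *)

Section LineCalculus.
Variable R : realType.

Lemma is_derive_quadratic (V : normedModType R) (f : V -> R) (a v : V)
    (D r C : R) : 0 < r ->
  (forall h : R, `|h| <= r -> `|f (h *: v + a) - f a - h * D| <= C * h ^+ 2) ->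
  is_derive a v f D.
Proof.
move=> r0 fD.
suff H : (h^-1 *: ((f \o shift a) (h *: v) - f a)) @[h --> 0^'] --> D.
  by split; [apply/cvg_ex; exists D|apply: cvg_lim].
apply/cvgrPdist_le => e e0; near=> h.
have h0 : h != 0 by near: h; exact: nbhs_dnbhs_neq.
have hr : `|h| <= r by near: h; exact: dnbhs0_le.
have hC : `|h| <= e / (`|C| + 1).
  by near: h; apply: dnbhs0_le; rewrite divr_gt0// ltr_wpDl.
rewrite /= distrC [X in `|X|](_ : _ = h^-1 * (f (h *: v + a) - f a - h * D)); last first.
  by rewrite mulrBr mulKf.
rewrite normrM normfV mulrC ler_pdivrMr ?normr_gt0// (le_trans (fD _ hr))//.
rewrite -real_normK ?num_real// expr2 mulrA ler_wpM2r//.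
apply: (@le_trans _ _ ((`|C| + 1) * `|h|)).
  by rewrite ler_wpM2r// (le_trans (ler_norm _))// lerDl.
by rewrite mulrC -ler_pdivlMr// ltr_wpDl.
Unshelve. all: by end_near. Qed.

Lemma is_derive_lineP (V : normedModType R) (f : V -> R) (a v : V) (D : R) :
  is_derive (0 : R) 1 (fun s : R => f (a + s *: v)) D -> is_derive a v f D.
Proof.
have E : (fun h : R => h^-1 *: (((fun s : R => f (a + s *: v)) \o shift 0) (h *: 1)
    - f (a + 0 *: v))) = fun h : R => h^-1 *: ((f \o shift a) (h *: v) - f a).
  apply/funext => h /=.
  by rewrite addr0 scale0r addr0 [h *: 1]mulr1 (addrC a).
by move=> [der val]; split; [move: der|move: val]; rewrite /derivable /derive E.
Qed.

Lemma le0_of_derive_le0 (f f' : R -> R) :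
  (forall s : R, 0 <= s <= 1 -> is_derive s 1 f (f' s)) ->
  (forall s, 0 <= s <= 1 -> f' s <= 0) -> f 0 <= 0 ->
  forall s, 0 <= s <= 1 -> f s <= 0.
Proof.
move=> df f'0 f0 s /andP[s0 s1]; apply: le_trans f0.
apply: (@ler0_derive1_le_cc R f 0 1) => //.
- move=> x; rewrite in_itv/= => /andP[x0 x1].
  by case: (df x _) => //; rewrite !ltW.
- move=> x; rewrite in_itv/= => /andP[x0 x1].
  by rewrite derive1E; case: (df x _) => [|_ ->]; [|apply: f'0]; rewrite !ltW.
- apply: derivable_within_continuous => x; rewrite in_itv/= => x01.
  by case: (df x x01).
- by rewrite in_itv/= s0.
- by rewrite in_itv/= lexx ler01.
Qed.

(** The inequality [K4 <= S] is integrated four times. Each [gi] is [Ki] minus the polynomial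
    expected from the data at 0; it vanishes at 0 and its derivative is the next one, already known
    to be nonpositive. *)
Lemma taylor4_le (K0 K1 K2 K3 K4 : R -> R) (S : R) :
  (forall s : R, 0 <= s <= 1 -> [/\ is_derive s 1 K0 (K1 s),
    is_derive s 1 K1 (K2 s), is_derive s 1 K2 (K3 s) &
    is_derive s 1 K3 (K4 s)]) ->
  (forall s, 0 <= s <= 1 -> K4 s <= S) ->
  K0 1 - K0 0 - K1 0 - K2 0 / 2 - K3 0 / 6 <= S / 24.
Proof.
move=> dK KS.
pose g3 s := K3 s - (K3 0 + S * s).
pose g2 s := K2 s - (K2 0 + K3 0 * s + S / 2 * s ^+ 2).
pose g1 s := K1 s - (K1 0 + K2 0 * s + K3 0 / 2 * s ^+ 2 + S / 6 * s ^+ 3).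
pose g0 s := K0 s - (K0 0 + K1 0 * s + K2 0 / 2 * s ^+ 2 + K3 0 / 6 * s ^+ 3
  + S / 24 * s ^+ 4).
pose p c0 c1 c2 c3 c4 : {poly R} := c0%:P + c1 *: 'X + c2 *: 'X^2 + c3 *: 'X^3 + c4 *: 'X^4.
have dp c0 c1 c2 c3 c4 (s : R) (f : R -> R) (df : R) : is_derive s 1 f df ->
    is_derive s 1 (fun s => f s - (c0 + c1 * s + c2 * s ^+ 2 + c3 * s ^+ 3 + c4 * s ^+ 4))
      (df - (c1 + 2 * c2 * s + 3 * c3 * s ^+ 2 + 4 * c4 * s ^+ 3)).
  move=> dfs.
  (* Passing to a formal polynomial lets its derivative be computed by the rules for [deriv]. *)
  have -> : (fun s => f s - (c0 + c1 * s + c2 * s ^+ 2 + c3 * s ^+ 3 + c4 * s ^+ 4)) =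
    f - (fun s => (p c0 c1 c2 c3 c4).[s]).
    apply/funext => x; rewrite -[RHS]/(f x - (p c0 c1 c2 c3 c4).[x]) /p.
    by rewrite !hornerE; ring.
  apply: is_derive_eq; congr (_ - _).
  by rewrite /p !(derivD, derivC, derivZ, derivX, derivXn) !hornerE /=; ring.
have g3_le0 : forall s, 0 <= s <= 1 -> g3 s <= 0.
  apply: (@le0_of_derive_le0 _ (fun s => K4 s - S)).
  - move=> s s01; case: (dK s s01) => _ _ _ d3.
    have := dp (K3 0) S 0 0 0 s _ _ d3.
    rewrite [X in is_derive _ _ X](_ : _ = g3); last by apply/funext => x; rewrite /g3; ring.
    by move/is_derive_eq; apply; ring.
  - by move=> s /KS; rewrite subr_le0.
  - by rewrite /g3 mulr0 addr0 subrr.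
have g2_le0 : forall s, 0 <= s <= 1 -> g2 s <= 0.
  apply: (@le0_of_derive_le0 _ g3) => //.
  - move=> s s01; case: (dK s s01) => _ _ d2 _.
    have := dp (K2 0) (K3 0) (S / 2) 0 0 s _ _ d2.
    rewrite [X in is_derive _ _ X](_ : _ = g2); last by apply/funext => x; rewrite /g2; ring.
    by move/is_derive_eq; apply; rewrite /g3; field.
  - by rewrite /g2 expr0n /=; lra.
have g1_le0 : forall s, 0 <= s <= 1 -> g1 s <= 0.
  apply: (@le0_of_derive_le0 _ g2) => //.
  - move=> s s01; case: (dK s s01) => _ d1 _ _.
    have := dp (K1 0) (K2 0) (K3 0 / 2) (S / 6) 0 s _ _ d1.
    rewrite [X in is_derive _ _ X](_ : _ = g1); last by apply/funext => x; rewrite /g1; ring.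
    by move/is_derive_eq; apply; rewrite /g2; field.
  - by rewrite /g1 !expr0n /=; lra.
have g0_le0 : forall s, 0 <= s <= 1 -> g0 s <= 0.
  apply: (@le0_of_derive_le0 _ g1) => //.
  - move=> s s01; case: (dK s s01) => d0 _ _ _.
    have := dp (K0 0) (K1 0) (K2 0 / 2) (K3 0 / 6) (S / 24) s _ _ d0.
    rewrite [X in is_derive _ _ X](_ : _ = g0); last by apply/funext => x; rewrite /g0; ring.
    by move/is_derive_eq; apply; rewrite /g1; field.
  - by rewrite /g0 !expr0n /=; lra.
have := g0_le0 1; rewrite lexx ler01 => /(_ isT).
by rewrite /g0 !expr1n; lra.
Qed.

Lemma taylor4 (K0 K1 K2 K3 K4 : R -> R) (S : R) :
  (forall s : R, 0 <= s <= 1 -> [/\ is_derive s 1 K0 (K1 s),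
    is_derive s 1 K1 (K2 s), is_derive s 1 K2 (K3 s) &
    is_derive s 1 K3 (K4 s)]) ->
  (forall s, 0 <= s <= 1 -> `|K4 s| <= S) ->
  `|K0 1 - K0 0 - K1 0 - K2 0 / 2 - K3 0 / 6| <= S / 24.
Proof.
move=> dK KS; rewrite ler_norml; apply/andP; split; last first.
  by apply: (taylor4_le dK) => s /KS; apply: le_trans; exact: ler_norm.
have : - K0 1 - - K0 0 - - K1 0 - (- K2 0) / 2 - (- K3 0) / 6 <= S / 24.
  apply: (@taylor4_le (\- K0) (\- K1) (\- K2) (\- K3) (\- K4)) => s s01.
    by have [d0 d1 d2 d3] := dK s s01; split; exact: is_deriveN.
  by apply: le_trans (KS s s01); rewrite -normrN ler_norm.
by lra.
Qed.

End LineCalculus.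

(** * Cumulants *)

Section Cumulants.
Variables (R : realType) (d : nat) (M : expfam R d).
Local Notation nu := (ef_nu M).
Local Notation Theta := (ef_Theta M).
Local Notation psi := (ef_psi M).
Implicit Types (t v x : 'cV[R]_d) (p q : 'cV[R]_d -> R).

(** The real-valued counterpart of [ef_expect], as [ef_expectE] shows; in quotient form,
    differentiation in the parameter is the quotient rule. *)
Definition expect p t : R := moment M p t / moment M (fun=> 1) t.

Lemma moment1_gt0 t : Theta t -> 0 < moment M (fun=> 1) t.
Proof. by move=> tT; rewrite moment1// expR_gt0. Qed.

Lemma moment1_neq0 t : Theta t -> moment M (fun=> 1) t != 0.
Proof. by move=> tT; rewrite gt_eqF// moment1_gt0. Qed.

Lemma expectD p q t : Theta t -> subexp p -> subexp q ->
  expect (fun x => p x + q x) t = expect p t + expect q t.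
Proof. by move=> tT sp sq; rewrite /expect momentD// mulrDl. Qed.

Lemma expectZ k p t : Theta t -> subexp p ->
  expect (fun x => k * p x) t = k * expect p t.
Proof. by move=> tT sp; rewrite /expect momentZ// mulrA. Qed.

Lemma expect_cst k t : Theta t -> expect (fun=> k) t = k.
Proof.
move=> tT; rewrite /expect.
rewrite (@eq_moment _ _ _ _ (fun x => k * (fun=> 1) x)); last by move=> x; rewrite mulr1.
by rewrite momentZ ?mulfK ?moment1_neq0//; exact: subexp_cst.
Qed.

Lemma eq_expect p q t : p =1 q -> expect p t = expect q t.
Proof. by move=> /funext ->. Qed.

Lemma expect_ge0 p t : Theta t -> (forall x, 0 <= p x) -> 0 <= expect p t.
Proof.
move=> tT p0; rewrite divr_ge0//; last by rewrite ltW ?moment1_gt0.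
by rewrite /moment Rintegral_ge0// => x _; rewrite mulr_ge0 ?ef_weight_ge0.
Qed.

Lemma subexp_sum (I : Type) (s : seq I) (F : I -> 'cV[R]_d -> R) :
  (forall i, subexp (F i)) -> subexp (fun x => \sum_(i <- s) F i x).
Proof.
move=> sF; elim: s => [|a s ih].
  by under eq_fun do rewrite big_nil; exact: subexp_cst.
by under eq_fun do rewrite big_cons; exact: subexpD.
Qed.

Lemma expect_sum (I : Type) (s : seq I) (F : I -> 'cV[R]_d -> R) t : Theta t ->
  (forall i, subexp (F i)) ->
  expect (fun x => \sum_(i <- s) F i x) t = \sum_(i <- s) expect (F i) t.
Proof.
move=> tT sF; elim: s => [|a s ih].
  by rewrite big_nil; under eq_expect do rewrite big_nil; exact: expect_cst.
rewrite big_cons -ih -expectD//; last exact: subexp_sum.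
by apply: eq_expect => x; rewrite big_cons.
Qed.

Lemma ef_expectE p t : Theta t -> subexp p -> ef_expect M t p = (expect p t)%:E.
Proof.
move=> tT sp; rewrite /ef_expect.
under eq_integral do rewrite ef_densityE mulrCA EFinM.
rewrite integralZl//; last exact: integrable_subexp.
rewrite /expect moment1// -expRN mulrC EFinM; congr (_ * _)%E.
rewrite /moment /Rintegral fineK//; apply: integrable_fin_num => //.
exact: integrable_subexp.
Qed.

Lemma subexp_coord i : subexp (fun x : 'cV[R]_d => x i 0).
Proof.
rewrite (_ : (fun x : 'cV[R]_d => x i 0) = fun x => dotp x (delta_mx i 0)).
  exact: subexp_dotp.
by apply/funext => x; rewrite dotpC dotp_delta.
Qed.

Lemma ef_meanE t : Theta t -> ef_mean M t = \col_i expect (fun x => x i 0) t.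
Proof.
by move=> tT; apply/colP => i; rewrite !mxE ef_expectE//; exact: subexp_coord.
Qed.

Lemma expect_dotp t v : Theta t ->
  expect (fun x => dotp x v) t = dotp (ef_mean M t) v.
Proof.
move=> tT; rewrite /dotp expect_sum => // [|i]; last first.
  by apply: subexpM; [exact: subexp_coord|exact: subexp_cst].
apply: eq_bigr => i _; rewrite ef_meanE// mxE [RHS]mulrC -expectZ//.
  by apply: eq_expect => x; rewrite mulrC.
exact: subexp_coord.
Qed.

Lemma is_derive_moment p t v (s : R) : Theta (t + s *: v) -> subexp p ->
  is_derive s 1 (fun s => moment M p (t + s *: v))
    (moment M (fun x => p x * dotp x v) (t + s *: v)).
Proof.
move=> tT sp; have [r r0 [C C0 H]] := moment_expansion tT sp.
have l1Z (h : R) : l1norm (h *: v) = `|h| * l1norm v.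
  by rewrite mulr_sumr; apply: eq_bigr => i _; rewrite mxE normrM.
have v1 : 0 < l1norm v + 1 by rewrite ltr_wpDl ?l1norm_ge0.
apply: (@is_derive_quadratic _ _ _ _ _ _ (r / (l1norm v + 1)) (C * l1norm v ^+ 2)).
  by rewrite divr_gt0.
move=> h; rewrite ler_pdivlMr// => hr.
have -> : t + (h *: 1 + s) *: v = t + s *: v + h *: v.
  by rewrite [h *: 1]mulr1 scalerDl (addrC (h *: v)) addrA.
have [|_] := H (h *: v).
  by rewrite l1Z; apply: le_trans hr; rewrite ler_wpM2l// lerDl.
rewrite l1Z exprMn real_normK ?num_real// mulrCA -mulrA [l1norm v ^+ 2 * _]mulrC mulrCA.
congr (`| _ - _ | <= _).
rewrite -momentZ//; last by apply: subexpM => //; exact: subexp_dotp.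
by apply: eq_moment => x; rewrite dotpZr mulrCA.
Qed.

(** The quotient rule produces the covariance of [p] with [dotp x v]; iterating it from the mean of
    [dotp x v] generates the cumulants. *)
Lemma is_derive_expect p t v (s : R) : Theta (t + s *: v) -> subexp p ->
  is_derive s 1 (fun s => expect p (t + s *: v))
    (expect (fun x => p x * dotp x v) (t + s *: v) -
     expect p (t + s *: v) * expect (fun x => dotp x v) (t + s *: v)).
Proof.
move=> tT sp.
have d1 := is_derive_moment tT sp.
have d2 := is_deriveV (moment1_neq0 tT) (is_derive_moment tT (subexp_cst d (1 : R))).
apply: is_derive_eq (is_deriveM d1 d2) _.
rewrite /expect -[_ *: _]/(_ * _) -[X in _ + X]/(_ * _).
rewrite -[X in _ * X + _]/(_ * _).
under (@eq_moment _ _ _ (fun x => 1 * dotp x v)) do rewrite mul1r.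
by field; exact: moment1_neq0.
Qed.

Lemma near_ef_Theta_line t v (s : R) : Theta (t + s *: v) ->
  \forall h \near s, Theta (t + h *: v).
Proof.
move=> tT; have [r r0 H] := ef_Theta_l1ball tT.
have v1 : 0 < l1norm v + 1 by rewrite ltr_wpDl ?l1norm_ge0.
have rv : 0 < r / (l1norm v + 1) by rewrite divr_gt0.
near=> h.
have hs : `|s - h| < r / (l1norm v + 1) by near: h; exact: cvgr_dist_lt.
have -> : t + h *: v = t + s *: v + (h - s) *: v.
  by rewrite -addrA -scalerDl subrKC.
apply: H; rewrite (_ : l1norm _ = `|h - s| * l1norm v).
  move: hs; rewrite distrC ltr_pdivlMr// => /ltW; apply: le_trans.
  by rewrite ler_wpM2l// lerDl.
by rewrite mulr_sumr; apply: eq_bigr => i _; rewrite mxE normrM.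
Unshelve. all: by end_near. Qed.

Lemma is_derive_psi t v (s : R) : Theta (t + s *: v) ->
  is_derive s 1 (fun s => psi (t + s *: v))
    (expect (fun x => dotp x v) (t + s *: v)).
Proof.
move=> tT.
have d1 := is_derive_moment tT (subexp_cst d (1 : R)).
have := is_derive1_comp (is_derive1_ln (moment1_gt0 tT)) d1.
(* [psi] is the logarithm of the moment of 1 only on [Theta], so the two functions are compared near
   [s] only. *)
move=> /(near_eq_is_derive _) H; apply: is_derive_eq (H _ _) _.
  near=> h; rewrite /= moment1 ?expRK//.
  by near: h; exact: near_ef_Theta_line.
rewrite mulrC /expect; congr (_ / _).
by apply: eq_moment => x; rewrite mul1r.
Unshelve. all: by end_near. Qed.

Lemma derive_psi t v : Theta t -> 'D_v psi t = expect (fun x => dotp x v) t.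
Proof.
move=> tT; have tT' : Theta (t + (0 : R) *: v) by rewrite scale0r addr0.
by have [_ ->] := is_derive_lineP (is_derive_psi tT'); rewrite scale0r addr0.
Qed.

Lemma ef_mu_mean t : Theta t -> ef_mu M t = ef_mean M t.
Proof.
move=> tT; rewrite ef_meanE//; apply/colP => i; rewrite !mxE derive_psi//.
by apply: eq_expect => x; rewrite dotpC dotp_delta.
Qed.

Lemma ef_F_cov t i j : Theta t -> ef_F M t i j =
  expect (fun x => x i 0 * x j 0) t -
  expect (fun x => x i 0) t * expect (fun x => x j 0) t.
Proof.
move=> tT; rewrite mxE.
have -> : 'D_(delta_mx i 0) ('D_(delta_mx j 0) psi) t =
    'D_(delta_mx i 0) (expect (fun x => x j 0)) t.
  apply: near_eq_derive; near=> u; rewrite derive_psi.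
    by apply: eq_expect => x; rewrite dotpC dotp_delta.
  by near: u; exact: open_nbhs_nbhs (conj (@ef_open _ _ M) tT).
have tT' : Theta (t + (0 : R) *: (delta_mx i 0)) by rewrite scale0r addr0.
have [_ ->] := is_derive_lineP (is_derive_expect tT' (subexp_coord j)).
rewrite scale0r addr0 mulrC; congr (_ - _ * _); apply: eq_expect => x.
  by rewrite dotpC dotp_delta mulrC.
by rewrite dotpC dotp_delta.
Unshelve. all: by end_near. Qed.

Lemma ef_F_quad t v : Theta t -> dotp v (ef_F M t *m v) =
  expect (fun x => dotp x v ^+ 2) t - expect (fun x => dotp x v) t ^+ 2.
Proof.
move=> tT.
have -> : expect (fun x => dotp x v ^+ 2) t =
    \sum_i \sum_j v i 0 * v j 0 * expect (fun x => x i 0 * x j 0) t.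
  rewrite (@eq_expect _ (fun x => \sum_i \sum_j v i 0 * v j 0 * (x i 0 * x j 0))).
    have s2 i j : subexp (fun x : 'cV[R]_d => x i 0 * x j 0).
      by apply: subexpM; exact: subexp_coord.
    have s3 i j : subexp (fun x : 'cV[R]_d => v i 0 * v j 0 * (x i 0 * x j 0)).
      by apply: subexpM; [exact: subexp_cst|exact: s2].
    rewrite expect_sum// => [|i]; last exact: subexp_sum.
    apply: eq_bigr => i _; rewrite expect_sum//.
    by apply: eq_bigr => j _; rewrite expectZ.
  move=> x; rewrite expr2 /dotp big_distrl; apply: eq_bigr => i _ /=.
  by rewrite big_distrr; apply: eq_bigr => j _ /=; ring.
rewrite expect_dotp// expr2 {2 3}/dotp big_distrl -sumrB; apply: eq_bigr => i _ /=.
rewrite mxE !big_distrr -sumrB/=; apply: eq_bigr => j _ /=.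
by rewrite ef_F_cov// ef_meanE// !mxE; ring.
Qed.

Lemma subexp_dotpX v n : subexp (fun x : 'cV[R]_d => dotp x v ^+ n).
Proof. by apply: subexpX; exact: subexp_dotp. Qed.

Lemma expect_poly4 t v (c0 c1 c2 c3 c4 : R) : Theta t ->
  expect (fun x => c0 + c1 * dotp x v + c2 * dotp x v ^+ 2 +
    c3 * dotp x v ^+ 3 + c4 * dotp x v ^+ 4) t =
  c0 + c1 * expect (fun x => dotp x v) t +
  c2 * expect (fun x => dotp x v ^+ 2) t +
  c3 * expect (fun x => dotp x v ^+ 3) t +
  c4 * expect (fun x => dotp x v ^+ 4) t.
Proof.
move=> tT.
have s1 (c : R) : subexp (fun x : 'cV[R]_d => c * dotp x v).
  by apply: subexpM; [exact: subexp_cst|exact: subexp_dotp].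
have sn (c : R) n : subexp (fun x : 'cV[R]_d => c * dotp x v ^+ n).
  by apply: subexpM; [exact: subexp_cst|exact: subexp_dotpX].
have s0 := subexp_cst d c0.
do 4 (rewrite expectD//; do ?apply: subexpD => //).
by rewrite expect_cst// !expectZ//; [exact: subexp_dotpX..|exact: subexp_dotp].
Qed.

(** Third cumulant of [dotp x v], written in raw moments: [is_derive_expect] differentiates the
    expectation of a fixed function, whereas a centred one would itself depend on [t]. *)
Definition cumulant3 t v : R :=
  expect (fun x => dotp x v ^+ 3) t
  - 3 * expect (fun x => dotp x v) t * expect (fun x => dotp x v ^+ 2) t
  + 2 * expect (fun x => dotp x v) t ^+ 3.

Definition cumulant4 t v : R :=
  expect (fun x => dotp x v ^+ 4) t
  - 4 * expect (fun x => dotp x v) t * expect (fun x => dotp x v ^+ 3) t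
  - 3 * expect (fun x => dotp x v ^+ 2) t ^+ 2
  + 12 * expect (fun x => dotp x v) t ^+ 2 * expect (fun x => dotp x v ^+ 2) t
  - 6 * expect (fun x => dotp x v) t ^+ 4.

Definition central_moment k t v : R :=
  expect (fun x => dotp (x - ef_mean M t) v ^+ k) t.

Lemma cumulant3E t v : Theta t -> cumulant3 t v = central_moment 3 t v.
Proof.
move=> tT; set m := expect (fun x => dotp x v) t.
rewrite /central_moment (@eq_expect _ (fun x => - m ^+ 3 + 3 * m ^+ 2 * dotp x v
  + (- (3 * m)) * dotp x v ^+ 2 + 1 * dotp x v ^+ 3 + 0 * dotp x v ^+ 4)).
  by rewrite expect_poly4// /cumulant3 -/m; ring.
by move=> x; rewrite dotpBl -expect_dotp// -/m; ring.
Qed.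

Lemma central_moment4E t v : Theta t -> central_moment 4 t v =
  cumulant4 t v + 3 * (expect (fun x => dotp x v ^+ 2) t
    - expect (fun x => dotp x v) t ^+ 2) ^+ 2.
Proof.
move=> tT; set m := expect (fun x => dotp x v) t.
rewrite /central_moment (@eq_expect _ (fun x => m ^+ 4 + (- (4 * m ^+ 3)) * dotp x v
  + 6 * m ^+ 2 * dotp x v ^+ 2 + (- (4 * m)) * dotp x v ^+ 3 + 1 * dotp x v ^+ 4)).
  by rewrite expect_poly4// /cumulant4 -/m; ring.
by move=> x; rewrite dotpBl -expect_dotp// -/m; ring.
Qed.

(* [Var Y^2 >= 0] for the centred variable [Y] bounds the squared variance by
   the fourth moment. *)
Lemma normr_cumulant4 t v : Theta t ->
  `|cumulant4 t v| <= 2 * central_moment 4 t v.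
Proof.
move=> tT; have := central_moment4E v tT.
set m := expect (fun x => dotp x v) t.
set q := expect (fun x => dotp x v ^+ 2) t => E.
have cm0 : 0 <= central_moment 4 t v.
  by apply: expect_ge0 => // x; rewrite -[4%N]/(2 * 2)%N exprM sqr_ge0.
have : 0 <= expect (fun x => (dotp (x - ef_mean M t) v ^+ 2 - (q - m ^+ 2)) ^+ 2) t.
  by apply: expect_ge0 => // x; exact: sqr_ge0.
rewrite (@eq_expect _ (fun x => (q - 2 * m ^+ 2) ^+ 2 + 4 * m * (q - 2 * m ^+ 2) * dotp x v
  + (4 * m ^+ 2 - 2 * (q - 2 * m ^+ 2)) * dotp x v ^+ 2
  + (- (4 * m)) * dotp x v ^+ 3 + 1 * dotp x v ^+ 4)); last first.
  by move=> x; rewrite dotpBl -expect_dotp// -/m; ring.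
rewrite expect_poly4// -/m -/q => H.
have {H} : (q - m ^+ 2) ^+ 2 <= central_moment 4 t v.
  rewrite -subr_ge0; apply: le_trans H _.
  by rewrite E /cumulant4 -/m -/q le_eqVlt; apply/orP; left; apply/eqP; ring.
(* The cumulant is the fourth central moment minus three times the squared variance, and that square
   lies between 0 and the fourth moment; hence the factor 2. *)
by have := sqr_ge0 (q - m ^+ 2); rewrite ler_norml; lra.
Qed.

Lemma cumulants_derive t v (s : R) : Theta (t + s *: v) ->
  [/\ is_derive s 1 (fun s => psi (t + s *: v))
        (expect (fun x => dotp x v) (t + s *: v)),
      is_derive s 1 (fun s => expect (fun x => dotp x v) (t + s *: v))
        (expect (fun x => dotp x v ^+ 2) (t + s *: v)
         - expect (fun x => dotp x v) (t + s *: v) ^+ 2),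
      is_derive s 1 (fun s => expect (fun x => dotp x v ^+ 2) (t + s *: v)
         - expect (fun x => dotp x v) (t + s *: v) ^+ 2)
        (cumulant3 (t + s *: v) v) &
      is_derive s 1 (fun s => cumulant3 (t + s *: v) v)
        (cumulant4 (t + s *: v) v)].
Proof.
move=> tT.
have d1 := is_derive_expect tT (subexp_dotp v).
have d2 := is_derive_expect tT (subexp_dotpX v 2).
have d3 := is_derive_expect tT (subexp_dotpX v 3).
have E n u : expect (fun x => dotp x v ^+ n * dotp x v) u =
    expect (fun x => dotp x v ^+ n.+1) u.
  by apply: eq_expect => x; rewrite exprSr.
rewrite !E in d2 d3.
have {}d1 : is_derive s 1 (fun s => expect (fun x => dotp x v) (t + s *: v))
    (expect (fun x => dotp x v ^+ 2) (t + s *: v)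
     - expect (fun x => dotp x v) (t + s *: v) ^+ 2).
  by apply: is_derive_eq d1 _; rewrite expr2; congr (_ - _); apply: eq_expect.
split => //; first exact: is_derive_psi.
- have := is_deriveB d2 (is_deriveX 2 d1).
  move/is_derive_eq; apply; rewrite /= expr1; set u := t + s *: v.
  by rewrite /cumulant3 /GRing.scale /=; ring.
- have := is_deriveD (is_deriveB d3 (is_deriveM (is_deriveZ 3 d1) d2))
    (is_deriveZ 2 (is_deriveX 3 d1)).
  rewrite [X in is_derive _ _ X](_ : _ = fun s => cumulant3 (t + s *: v) v); last first.
    by apply/funext => z.
  move/is_derive_eq; apply; rewrite /=; set u := t + s *: v.
  by rewrite /cumulant4 /GRing.scale /=; ring.
Qed.

(** The third-order term is evaluated at [t] alone, matching [B1] at 0, and the fourth-order one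
    along the segment, matching [B2] at [c]. The constant is [2 * S / 24], with the 2 from
    [normr_cumulant4]. *)
Lemma psi_taylor t v (S : R) :
  (forall s : R, 0 <= s <= 1 -> Theta (t + s *: v)) ->
  (forall s : R, 0 <= s <= 1 -> central_moment 4 (t + s *: v) v <= S) ->
  `|psi (t + v) - psi t - dotp (ef_mu M t) v - dotp v (ef_F M t *m v) / 2|
    <= `|central_moment 3 t v| / 6 + S / 12.
Proof.
move=> tT tS.
have t0 : Theta t by have := tT 0; rewrite lexx ler01 scale0r addr0; exact.
have := taylor4 (fun s s01 => cumulants_derive (tT s s01)).
move=> /(_ (2 * S)); rewrite scale1r !scale0r !addr0.
have h s : 0 <= s <= 1 -> `|cumulant4 (t + s *: v) v| <= 2 * S.
  move=> s01; rewrite (le_trans (normr_cumulant4 _ (tT s s01)))//.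
  by rewrite ler_pM2l// tS.
move=> /(_ h); rewrite -ef_F_quad// expect_dotp// -ef_mu_mean// cumulant3E//.
move=> H; set Q := _ - dotp v _ / 2 in H *.
rewrite -[Q](subrK (central_moment 3 t v / 6)) (le_trans (ler_normD _ _))//.
rewrite addrC lerD// ?(le_trans H)//; last by lra.
by rewrite normrM [`|6^-1|]ger0_norm// invr_ge0.
Qed.

Lemma ef_Theta_segment t u (s : R) : Theta t -> Theta u -> 0 <= s <= 1 ->
  Theta (t + s *: (u - t)).
Proof.
move=> tT uT /andP[s0 s1]; pose k : {i01 R} := Itv01 s0 s1.
have := @ef_convex _ _ M u t k (mem_set uT) (mem_set tT).
move/set_mem; congr (ef_Theta M _).
by rewrite scalerBr addrCA -[X in _ + (X - _)]scale1r -scalerBl.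
Qed.

(* Integrating the weighted AM-GM inequality between the two normalised
   densities replaces Hoelder's inequality. *)
Lemma psi_convex t u (s : R) : Theta t -> Theta u -> 0 <= s <= 1 ->
  psi (t + s *: (u - t)) <= (1 - s) * psi t + s * psi u.
Proof.
move=> tT uT s01; have ts := ef_Theta_segment tT uT s01.
have /andP[s0 s1] := s01.
(* Convexity of the exponential, from its tangent line at the barycentre [c]. *)
have amgm (a b : R) : expR ((1 - s) * a + s * b) <= (1 - s) * expR a + s * expR b.
  set c := (1 - s) * a + s * b.
  have ha := ler_wpM2l (expR_ge0 c) (expR_ge1Dx (a - c)).
  have hb := ler_wpM2l (expR_ge0 c) (expR_ge1Dx (b - c)).
  move: ha hb; rewrite -!expRD !(addrC c) !subrK => ha hb.
  have h1 : 0 <= 1 - s by rewrite subr_ge0.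
  have := lerD (ler_wpM2l h1 ha) (ler_wpM2l s0 hb); apply: le_trans.
  by rewrite le_eqVlt; apply/orP; left; apply/eqP; rewrite /c; ring.
set c := (1 - s) * psi t + s * psi u.
rewrite -ler_expR -moment1//.
have i1 r : Theta r -> nu.-integrable setT (EFin \o (fun x => 1 * ef_weight M r x)).
  by move=> rT; apply: integrable_subexp => //; exact: subexp_cst.
have iZ k r : Theta r -> nu.-integrable setT (EFin \o (fun x => k * (1 * ef_weight M r x))).
  by move=> rT; apply: eq_integrable (integrableZl measurableT k (i1 _ rT)).
have -> : expR c = \int[nu]_x ((1 - s) * expR (c - psi t) * (1 * ef_weight M t x)
    + s * expR (c - psi u) * (1 * ef_weight M u x)).
  rewrite RintegralD//; [|exact: iZ..].
  rewrite (RintegralZl _ measurableT (i1 _ tT)) (RintegralZl _ measurableT (i1 _ uT)).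
  rewrite -!/(moment M (fun=> 1) _) !moment1// -!mulrA -!expRD !subrK.
  by rewrite -mulrDl subrK mul1r.
apply: le_Rintegral => //; first exact: i1.
  by apply: eq_integrable (integrableD measurableT
    (iZ ((1 - s) * expR (c - psi t)) _ tT) (iZ (s * expR (c - psi u)) _ uT)).
move=> x _; rewrite !mul1r !ef_weightE.
have := amgm (dotp x t - psi t) (dotp x u - psi u).
move=> /(ler_wpM2l (mulr_ge0 (ef_h_ge0 M x) (expR_ge0 c))).
congr (_ <= _).
  rewrite -mulrA -expRD; congr (_ * expR _); rewrite /c dotpDr dotpZr dotpBr; ring.
by rewrite !expRD; ring.
Qed.

End Cumulants.

(** * Integration on column vectors *)

Section ChangeOfDensity.
Context (disp : measure_display) (T : measurableType disp) (R : realType).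
Variables (mu m : {measure set T -> \bar R}) (dens : T -> R).
Hypothesis dens_ge0 : forall x, 0 <= dens x.
Hypothesis mdens : measurable_fun setT dens.
Hypothesis m_dens :
  forall A, measurable A -> m A = (\int[mu]_(x in A) (dens x)%:E)%E.
Local Open Scope ereal_scope.
Import HBNNSimple.

Lemma integral_density_nnsfun (f : {nnsfun T >-> R}) :
  \int[m]_x (f x)%:E = \int[mu]_x ((f x)%:E * (dens x)%:E).
Proof.
rewrite integralT_nnsfun sintegralE.
have E x : (f x)%:E * (dens x)%:E = \sum_(y \in range f)
    (y%:E * (\1_(f @^-1` [set y]) x * dens x)%:E).
  rewrite {1}(fimfunE f x) -fsumEFin// ge0_mule_fsuml//; last first.
    move=> y; rewrite lee_fin indicE; have [|_] := boolP (_ \in _); last by rewrite mulr0.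
    by rewrite inE /= => <-; rewrite mulr1.
  by apply: eq_fsbigr => y _; rewrite -!EFinM mulrA.
under [RHS]eq_integral do rewrite E.
have mB y : measurable_fun setT (fun x => (\1_(f @^-1` [set y]) x * dens x)%:E).
  by apply/measurable_EFinP/measurable_funM.
rewrite ge0_integral_fsum//; last 2 first.
- by move=> y; exact: measurable_funeM.
- move=> y x _; rewrite -EFinM lee_fin indicE; have [|_] := boolP (_ \in _).
    by rewrite inE /= => <-; rewrite mul1r mulr_ge0.
  by rewrite mul0r mulr0.
apply: eq_fsbigr => y; rewrite inE => -[z _ yE].
rewrite ge0_integralZl_EFin//; last 2 first.
- by move=> x _; rewrite lee_fin mulr_ge0// indicE.
- by rewrite -yE.
congr (_ * _); rewrite m_dens// integral_mkcond; apply: eq_integral => x _.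
rewrite /patch indicE; case: ifPn => _; last by rewrite mul0r.
by rewrite mul1r.
Qed.

(** [has_density] describes the law on sets only; simple functions and monotone convergence carry it
    over to integrals. *)
Lemma ge0_integral_density (f : T -> \bar R) :
  measurable_fun setT f -> (forall x, 0 <= f x) ->
  \int[m]_x f x = \int[mu]_x (f x * (dens x)%:E).
Proof.
move=> mf f0; pose f_ := nnsfun_approx measurableT mf.
have cvf x : (f_ n x)%:E @[n --> \oo] --> f x by exact: cvg_nnsfun_approx.
have nd x : {homo (fun n => (f_ n x)%:E) : a b / (a <= b)%N >-> a <= b}.
  by move=> a b ab; rewrite lee_fin; exact/lefP/nd_nnsfun_approx.
transitivity (limn (fun n => \int[m]_x (f_ n x)%:E)).
  rewrite -monotone_convergence//.
  - by apply: eq_integral => x _; apply/esym/cvg_lim.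
  - by move=> n; exact/measurable_EFinP.
  - by move=> n x _; rewrite lee_fin.
under eq_fun do rewrite integral_density_nnsfun.
rewrite -monotone_convergence//.
- apply: eq_integral => x _; apply/cvg_lim => //.
  by apply: cvgeZr => //.
- by move=> n; apply/measurable_EFinP/measurable_funM.
- by move=> n x _; rewrite -EFinM lee_fin mulr_ge0.
- by move=> x _ a b ab; apply: lee_wpmul2r; [rewrite lee_fin|exact: nd].
Qed.

End ChangeOfDensity.

Section ProductIntegral.
Variable R : realType.

Lemma integral_lebesgue_cVS (n : nat) (f : 'cV[R]_n.+1 -> \bar R) :
  measurable_fun setT f -> (forall x, 0 <= f x)%E ->
  (\int[lebesgue_cV R n.+1]_x f x =
   \int[lebesgue_measure]_a \int[lebesgue_cV R n]_x f (cV_cons (a, x)))%E.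
Proof.
move=> mf f0.
rewrite [LHS](@ge0_integral_pushforward _ _ _ _ R (@cV_cons R n)
  (@measurable_cV_cons R n) (lebesgue_measure \x lebesgue_cV R n)%E setT f)//.
rewrite preimage_setT fubini_tonelli1//; last by move=> x; exact: f0.
by apply: measurableT_comp => //; exact: measurable_cV_cons.
Qed.

Lemma integral_prod_cV (n : nat) (f : 'I_n -> R -> R) :
  (forall i, measurable_fun setT (f i)) -> (forall i a, 0 <= f i a) ->
  (\int[lebesgue_cV R n]_x (\prod_(i < n) f i (x i 0))%:E =
   \prod_(i < n) \int[lebesgue_measure]_a (f i a)%:E)%E.
Proof.
elim: n f => [|n IH] f mf f0.
  rewrite big_ord0; under eq_integral do rewrite big_ord0.
  by rewrite integral_dirac//= diracT mul1e.
have mp k (g : 'I_k -> R -> R) : (forall i, measurable_fun setT (g i)) ->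
    measurable_fun setT (fun x : 'cV[R]_k => (\prod_(i < k) g i (x i 0))%:E).
  move=> mg; apply/measurable_EFinP/measurable_prod => i _.
  by apply: measurableT_comp => //; exact: measurable_cV_coord.
rewrite integral_lebesgue_cVS//; [|exact: mp|by move=> x; rewrite lee_fin prodr_ge0].
rewrite big_ord_recl -IH//.
rewrite -ge0_integralZr//; last 3 first.
- by apply/measurable_EFinP; exact: mf.
- by move=> a _; rewrite lee_fin.
- by apply: integral_ge0 => x _; rewrite lee_fin prodr_ge0.
apply: eq_integral => a _.
rewrite -ge0_integralZl_EFin//; last 2 first.
- by move=> x _; rewrite lee_fin prodr_ge0.
- exact: (mp n (fun i => f (lift ord0 i))).
apply: eq_integral => x _; rewrite -EFinM; congr EFin.
rewrite big_ord_recl; congr (_ * _); first by rewrite mxE unlift_none.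
by apply: eq_bigr => i _; rewrite mxE liftK.
Qed.

Lemma gauss_density1E (d : nat) (m u : 'cV[R]_d) : gauss_density m 1%:M u =
  \prod_(i < d) normal_pdf (m i 0) 1 (u i 0).
Proof.
rewrite /gauss_density invmx1 mul1mx det1 mulr1 mulrC.
under eq_bigr do rewrite normal_pdfE ?oner_neq0//.
rewrite big_split/= prodr_const card_ord; congr (_ * _).
  rewrite /normal_peak expr1n mul1r exprVn; congr (_^-1).
  elim: d {m u} => [|d IH]; first by rewrite !expr0 sqrtr1.
  rewrite exprS sqrtrM; last by rewrite mulr_ge0// pi_ge0.
  by rewrite IH mulr_natl -exprS.
rewrite -expR_sum /dotp mulr_suml -sumrN; congr expR; apply: eq_bigr => i _.
by rewrite !mxE /normal_fun expr1n mulr2n; field.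
Qed.

Lemma measurable_gauss_density (d : nat) (m : 'cV[R]_d) :
  measurable_fun setT (gauss_density m 1%:M).
Proof.
rewrite (_ : gauss_density m 1%:M =
  fun u => \prod_(i < d) normal_pdf (m i 0) 1 (u i 0)); last first.
  by apply/funext => u; exact: gauss_density1E.
apply: measurable_prod => i _; apply: measurableT_comp.
  exact: measurable_normal_pdf.
exact: measurable_cV_coord.
Qed.

Lemma gauss_density_ge0 (d : nat) (m u : 'cV[R]_d) : 0 <= gauss_density m 1%:M u.
Proof. by rewrite gauss_density1E prodr_ge0// => i _; exact: normal_pdf_ge0. Qed.

Lemma integral_gauss_density (d : nat) (m : 'cV[R]_d) :
  (\int[lebesgue_cV R d]_u (gauss_density m 1%:M u)%:E = 1)%E.
Proof.
under eq_integral do rewrite gauss_density1E.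
rewrite (integral_prod_cV (f := fun i => normal_pdf (m i 0) 1)).
- by rewrite big1// => i _; rewrite integral_normal_pdf ?oner_neq0.
- by move=> i; exact: measurable_normal_pdf.
- by move=> i a; exact: normal_pdf_ge0.
Qed.

(** An unnormalised product of Cauchy densities: an explicit integrable majorant for the tails. *)
Definition cauchy_prod (d : nat) (u : 'cV[R]_d) : R :=
  \prod_(i < d) (oneDsqr (u i 0))^-1.

Lemma measurable_oneDsqrV : measurable_fun setT (fun x : R => (oneDsqr x)^-1).
Proof. by apply: continuous_measurable_fun; exact: continuous_oneDsqrV. Qed.

Lemma cauchy_prod_ge0 (d : nat) (u : 'cV[R]_d) : 0 <= cauchy_prod u.
Proof. by apply: prodr_ge0 => i _; rewrite invr_ge0. Qed.

Lemma measurable_cauchy_prod (d : nat) : measurable_fun setT (@cauchy_prod d).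
Proof.
apply: measurable_prod => i _; apply: (measurableT_comp measurable_oneDsqrV).
exact: measurable_cV_coord.
Qed.

Lemma integral_cauchy_prod (d : nat) :
  (\int[lebesgue_cV R d]_u (cauchy_prod u)%:E = (pi ^+ d)%:E)%E.
Proof.
rewrite (integral_prod_cV (f := fun i a => (oneDsqr a)^-1)).
- rewrite (eq_bigr (fun=> (pi : R)%:E)).
    by rewrite prodEFin prodr_const card_ord.
  move=> i _; rewrite ge0_symfun_integralT.
  - rewrite -set_itvcy integral0y_oneDsqr -EFinM; congr EFin; by field.
  - by move=> x; rewrite invr_ge0.
  - exact: continuous_oneDsqrV.
  - by move=> x; rewrite /= /oneDsqr sqrrN.
- by move=> i; exact: measurable_oneDsqrV.
- by move=> i a; rewrite invr_ge0.
Qed.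

End ProductIntegral.

(** * Independent samples *)

Lemma Rintegral_sum (disp : measure_display) (T : measurableType disp)
    (R : realType) (mu : {measure set T -> \bar R}) (I : Type) (s : seq I)
    (F : I -> T -> R) :
  (forall i, mu.-integrable setT (EFin \o F i)) ->
  mu.-integrable setT (EFin \o (fun x => \sum_(i <- s) F i x)) /\
  \int[mu]_x (\sum_(i <- s) F i x) = \sum_(i <- s) \int[mu]_x F i x.
Proof.
move=> iF; elim: s => [|a s [ints IH]].
  rewrite (_ : (fun x : T => \sum_(i <- [::]) F i x) = cst 0); last first.
    by apply/funext => x; rewrite big_nil.
  by rewrite big_nil Rintegral_cst// mul0r; split=> //; exact: integrable0.
rewrite (_ : (fun x : T => \sum_(i <- a :: s) F i x) =
  fun x => F a x + \sum_(i <- s) F i x); last first.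
  by apply/funext => x; rewrite big_cons.
rewrite big_cons -IH; split; last exact: RintegralD.
by apply: eq_integrable (integrableD measurableT (iF a) ints).
Qed.

Lemma subexp_norm (R : realType) (d : nat) (p : 'cV[R]_d -> R) :
  subexp p -> subexp (fun x => `|p x|).
Proof.
move=> [mp sp]; split=> [|e e0]; first exact: measurableT_comp.
by have [C C0 pC] := sp _ e0; exists C => // x; rewrite normr_id.
Qed.

Section Sampling.
Context (disp : measure_display) (Omega : measurableType disp) (R : realType)
  (P : probability Omega R) (d : nat) (M : expfam R d) (t0 : 'cV[R]_d).
Hypothesis t0_in : ef_Theta M t0.
Implicit Types (X Y : {RV P >-> 'cV[R]_d}) (f g : 'cV[R]_d -> R).

Lemma measurable_ef_density t : measurable_fun setT (ef_density M t).
Proof.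
rewrite (_ : ef_density M t = fun x => expR (- ef_psi M t) * ef_weight M t x).
  by apply: measurable_funM => //; exact: measurable_ef_weight.
by apply/funext => x; exact: ef_densityE.
Qed.

Lemma ef_density_ge0 t x : 0 <= ef_density M t x.
Proof. by rewrite ef_densityE mulr_ge0 ?expR_ge0 ?ef_weight_ge0. Qed.

Lemma ge0_integral_distr X f : has_density X M t0 -> subexp f ->
  (forall x, 0 <= f x) ->
  (\int[distribution P X]_x (f x)%:E = (expect M f t0)%:E)%E.
Proof.
move=> XM sf f0.
rewrite (ge0_integral_density (ef_density_ge0 t0) (measurable_ef_density t0) XM).
- by rewrite -ef_expectE//; apply: eq_integral => x _; rewrite -EFinM.
- by apply/measurable_EFinP; case: sf.
- by move=> x; rewrite lee_fin.
Qed.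

Lemma pair_measurable X Y : measurable_fun setT (fun w => (X w, Y w)).
Proof. by apply/measurable_fun_pairP; split; exact: measurable_funP. Qed.

Definition independent_pair X Y : Prop := forall A B,
  measurable A -> measurable B ->
  P (X @^-1` A `&` Y @^-1` B) = (P (X @^-1` A) * P (Y @^-1` B))%E.

Lemma ge0_integral_pair X Y f g : independent_pair X Y ->
  has_density X M t0 -> has_density Y M t0 -> subexp f -> subexp g ->
  (forall x, 0 <= f x) -> (forall x, 0 <= g x) ->
  (\int[P]_w (f (X w) * g (Y w))%:E = (expect M f t0 * expect M g t0)%:E)%E.
Proof.
move=> indXY XM YM sf sg f0 g0.
pose h (z : 'cV[R]_d * 'cV[R]_d) : \bar R := (f z.1 * g z.2)%:E.
have mh : measurable_fun setT h.
  apply/measurable_EFinP/measurable_funM.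
    by apply: measurableT_comp => //; case: sf.
  by apply: measurableT_comp => //; case: sg.
have h0 z : (0 <= h z)%E by rewrite lee_fin mulr_ge0.
pose Zm := isMeasurableFun.Build _ _ _ _ _ (pair_measurable X Y).
pose Z : {RV P >-> ('cV[R]_d * 'cV[R]_d)%type} := HB.pack (fun w => (X w, Y w)) Zm.
transitivity (\int[distribution P Z]_z h z)%E.
  by rewrite ge0_integral_distribution.
(* Independence identifies the joint law with the product law on rectangles, and uniqueness of the
   product measure extends this to all measurable sets. *)
transitivity (\int[distribution P X \x distribution P Y]_z h z)%E.
  apply: eq_measure_integral => A mA _; apply/esym.
  exact: product_measure_unique.
rewrite fubini_tonelli1// /fubini_F.
transitivity (\int[distribution P X]_x ((f x)%:E * (expect M g t0)%:E))%E.
  apply: eq_integral => x _; rewrite -(ge0_integral_distr YM)// -ge0_integralZl_EFin//.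
  - by move=> y _; rewrite lee_fin.
  - by apply/measurable_EFinP; case: sg.
rewrite ge0_integralZr//.
- by rewrite ge0_integral_distr.
- by apply/measurable_EFinP; case: sf.
- by move=> x _; rewrite lee_fin.
- by rewrite lee_fin expect_ge0.
Qed.

Lemma measurable_RV_comp X f : measurable_fun setT f ->
  measurable_fun setT (fun w => f (X w)).
Proof. by move=> mf; apply: measurableT_comp => //; exact: measurable_funP. Qed.

Lemma integrable_pair X Y f g : independent_pair X Y ->
  has_density X M t0 -> has_density Y M t0 -> subexp f -> subexp g ->
  P.-integrable setT (EFin \o (fun w => f (X w) * g (Y w))).
Proof.
move=> indXY XM YM sf sg; apply/integrableP; split.
  apply/measurable_EFinP/measurable_funM.
    by apply: measurable_RV_comp; case: sf.
  by apply: measurable_RV_comp; case: sg.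
under eq_integral do rewrite /= normrM.
by rewrite (ge0_integral_pair indXY XM YM (subexp_norm sf) (subexp_norm sg))// ltry.
Qed.

(* Writing [f = (f + |f|) - |f|] reduces to nonnegative functions. *)
Lemma Rintegral_pair X Y f g : independent_pair X Y ->
  has_density X M t0 -> has_density Y M t0 -> subexp f -> subexp g ->
  \int[P]_w (f (X w) * g (Y w)) = expect M f t0 * expect M g t0.
Proof.
move=> indXY XM YM sf sg.
pose f1 x := f x + `|f x|; pose f2 x : R := `|f x|.
pose g1 x := g x + `|g x|; pose g2 x : R := `|g x|.
have pos0 (r : R) : 0 <= r + `|r| by have := ler_norm (- r); rewrite normrN; lra.
have sf2 : subexp f2 by exact: subexp_norm.
have sg2 : subexp g2 by exact: subexp_norm.
have sf1 : subexp f1 by exact: subexpD.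
have sg1 : subexp g1 by exact: subexpD.
have I p q : subexp p -> subexp q -> (forall x, 0 <= p x) -> (forall x, 0 <= q x) ->
    \int[P]_w (p (X w) * q (Y w)) = expect M p t0 * expect M q t0.
  by move=> sp sq p0 q0; rewrite /Rintegral ge0_integral_pair.
have i p q : subexp p -> subexp q ->
    P.-integrable setT (EFin \o (fun w => p (X w) * q (Y w))).
  exact: integrable_pair.
have Ef : expect M f t0 = expect M f1 t0 - expect M f2 t0 by rewrite expectD// addrK.
have Eg : expect M g t0 = expect M g1 t0 - expect M g2 t0 by rewrite expectD// addrK.
have i1 : P.-integrable setT (EFin \o (fun w => f1 (X w) * g1 (Y w) - f2 (X w) * g1 (Y w))).
  by apply: eq_integrable (integrableB measurableT (i f1 g1 sf1 sg1) (i f2 g1 sf2 sg1)).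
have i2 : P.-integrable setT (EFin \o (fun w => f1 (X w) * g2 (Y w) - f2 (X w) * g2 (Y w))).
  by apply: eq_integrable (integrableB measurableT (i f1 g2 sf1 sg2) (i f2 g2 sf2 sg2)).
rewrite Ef Eg; transitivity (\int[P]_w ((f1 (X w) * g1 (Y w) - f2 (X w) * g1 (Y w)) -
    (f1 (X w) * g2 (Y w) - f2 (X w) * g2 (Y w)))).
  by apply: eq_Rintegral => w _; rewrite /f1 /f2 /g1 /g2; ring.
rewrite RintegralB// !RintegralB//; [|exact: i..].
have f10 x : 0 <= f1 x by exact: pos0.
have g10 x : 0 <= g1 x by exact: pos0.
have f20 x : 0 <= f2 x by exact: normr_ge0.
have g20 x : 0 <= g2 x by exact: normr_ge0.
by rewrite !I//; ring.
Qed.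

Lemma ge0_integral_RV X f : has_density X M t0 -> subexp f ->
  (forall x, 0 <= f x) ->
  (\int[P]_w (f (X w))%:E = (expect M f t0)%:E)%E.
Proof.
move=> XM sf f0; rewrite -(ge0_integral_distr XM)// ge0_integral_distribution//.
by apply/measurable_EFinP; case: sf.
Qed.

Lemma integrable_RV X f : has_density X M t0 -> subexp f ->
  P.-integrable setT (EFin \o (fun w => f (X w))).
Proof.
move=> XM sf; apply/integrableP; split.
  by apply/measurable_EFinP; apply: measurable_RV_comp; case: sf.
by rewrite /= (ge0_integral_RV XM (subexp_norm sf))// ltry.
Qed.

Lemma mutually_independent_pair (n : nat) (X : 'I_n -> {RV P >-> 'cV[R]_d}) i j :
  mutually_independent X -> i != j -> independent_pair (X i) (X j).
Proof.
move=> indX ij A B mA mB.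
have := indX [set i; j]%SET (fun k => if k == i then A else B).
have -> : \bigcap_(k in [set k | k \in [set i; j]%SET])
    X k @^-1` (if k == i then A else B) = X i @^-1` A `&` X j @^-1` B.
  apply/seteqP; split=> [w H|w [wA wB] k].
    split; first by have := H i; rewrite /= eqxx; apply; rewrite !inE eqxx.
    by have := H j; rewrite /= eq_sym (negbTE ij); apply; rewrite !inE eqxx orbT.
  rewrite /= !inE => /orP[/eqP ->|/eqP ->]; first by rewrite eqxx.
  by rewrite eq_sym (negbTE ij).
rewrite big_setU1 ?inE// big_set1 eqxx eq_sym (negbTE ij); apply => k.
by case: ifP.
Qed.

(** Expanding the square, the off-diagonal terms factor by pairwise independence and vanish because
    [f] is centred. *)
Lemma Rintegral_sum_sqr (n : nat) (X : 'I_n -> {RV P >-> 'cV[R]_d}) f :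
  mutually_independent X -> (forall i, has_density (X i) M t0) ->
  subexp f -> expect M f t0 = 0 ->
  P.-integrable setT (EFin \o (fun w => (\sum_(i < n) f (X i w)) ^+ 2)) /\
  \int[P]_w ((\sum_(i < n) f (X i w)) ^+ 2) =
    n%:R * expect M (fun x => f x ^+ 2) t0.
Proof.
move=> indX XM sf f0.
have i2 i j : P.-integrable setT (EFin \o (fun w => f (X i w) * f (X j w))).
  have [->|ij] := eqVneq i j; last first.
    by apply: integrable_pair => //; exact: mutually_independent_pair.
  exact: (integrable_RV (XM j) (subexpM sf sf)).
have I2 i j : \int[P]_w (f (X i w) * f (X j w)) =
    (i == j)%:R * expect M (fun x => f x ^+ 2) t0.
  have [<-|ij] := eqVneq i j; last first.
    rewrite mul0r Rintegral_pair ?f0 ?mul0r//.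
    exact: mutually_independent_pair.
  rewrite mul1r /Rintegral.
  have := ge0_integral_RV (XM i) (subexpX 2 sf) (fun x => sqr_ge0 _).
  by move=> /(congr1 fine).
rewrite (_ : (fun w => (\sum_(i < n) f (X i w)) ^+ 2) =
  fun w => \sum_(i < n) \sum_(j < n) f (X i w) * f (X j w)); last first.
  apply/funext => w; rewrite expr2 big_distrl; apply: eq_bigr => i _ /=.
  by rewrite big_distrr.
have [ii II] := Rintegral_sum (index_enum 'I_n)
  (fun i => (Rintegral_sum (index_enum 'I_n) (i2 i)).1).
split=> //; rewrite II.
rewrite (eq_bigr (fun=> expect M (fun x => f x ^+ 2) t0)); last first.
  move=> i _; rewrite (Rintegral_sum (index_enum 'I_n) (i2 i)).2.
  rewrite (bigD1 i)//= I2 eqxx mul1r big1 ?addr0// => j ji.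
  by rewrite I2 eq_sym (negbTE ji) mul0r.
by rewrite sumr_const card_ord mulr_natl.
Qed.

End Sampling.

(** * The symmetric square root of the information matrix *)

Section SymmetricRoot.
Variables (R : realType) (d : nat) (J F : 'M[R]_d).
Hypothesis (JF : is_sym_sqrt J F) (F_unit : F \in unitmx).

Lemma sym_sqrt_unitmx : J \in unitmx.
Proof. by case: JF => _ _ JJ; move: F_unit; rewrite -JJ unitmx_mul => /andP[]. Qed.

Lemma sym_sqrt_invmx_tr : (invmx J)^T = invmx J.
Proof. by case: JF => JT _ _; rewrite trmx_inv JT. Qed.

Lemma sym_sqrt_invmxM : invmx J *m invmx J = invmx F.
Proof.
have uJ := sym_sqrt_unitmx; case: JF => _ _ JJ.
apply: (can_inj (mulKmx F_unit)); rewrite mulmxV// -JJ -mulmxA.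
by rewrite (mulmxA J (invmx J)) mulmxV// mul1mx mulmxV.
Qed.

Lemma dotp_sym_sqrt (u : 'cV[R]_d) :
  dotp (invmx J *m u) (F *m (invmx J *m u)) = dotp u u.
Proof.
have uJ := sym_sqrt_unitmx; case: JF => JT _ <-.
by rewrite -!mulmxA dotp_mulmxr JT !mulKVmx.
Qed.

(** The left side is [<u, F^-1 u>] by symmetry of [J], so the operator norm of [F^-1] appears to the
    first power, as in the prior radius. *)
Lemma sqr_enorm_sym_sqrt_inv (u : 'cV[R]_d) :
  enorm (invmx J *m u) ^+ 2 <= opnorm (invmx F) * enorm u ^+ 2.
Proof.
rewrite sqr_enorm dotp_mulmxr sym_sqrt_invmx_tr mulmxA sym_sqrt_invmxM.
rewrite (le_trans (dotp_le_enorm _ _))// expr2 mulrA ler_wpM2r ?enorm_ge0//.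
exact: enorm_mulmx.
Qed.

Lemma opnorm_ge0 (A : 'M[R]_d) : 0 <= opnorm A.
Proof.
have [d0|d0] := posnP d; last first.
  have := enorm_mulmx A (delta_mx (Ordinal d0) 0).
  rewrite (_ : enorm (delta_mx _ _) = 1) ?mulr1; last first.
    by rewrite /enorm dotp_delta mxE !eqxx sqrtr1.
  by apply: le_trans; exact: enorm_ge0.
rewrite /opnorm (_ : image _ _ = [set 0]) ?sup1//.
apply/seteqP; split=> [_ [x _ <-]|_ ->]; last first.
  exists 0; last by rewrite mulmx0 /enorm dotp0r sqrtr0.
  by rewrite /= /enorm dotp0r sqrtr0.
rewrite /= /enorm (_ : A *m x = 0) ?dotp0r ?sqrtr0//.
by apply/matrixP => i; have := ltn_ord i; rewrite {2}d0.
Qed.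

End SymmetricRoot.

(** * Second moment and tail of the normalised score *)

Section DeltaTail.
Context (disp : measure_display) (Omega : measurableType disp) (R : realType)
  (P : probability Omega R) (d : nat) (M : expfam R d) (t0 : 'cV[R]_d)
  (J : 'M[R]_d) (n : nat) (X : 'I_n -> {RV P >-> 'cV[R]_d}).
Hypothesis t0_in : ef_Theta M t0.
Hypothesis F_unit : ef_F M t0 \in unitmx.
Hypothesis J_sqrt : is_sym_sqrt J (ef_F M t0).
Hypothesis X_indep : mutually_independent X.
Hypothesis X_density : forall i, has_density (X i) M t0.
Hypothesis n_gt0 : (0 < n)%N.

Let D w := Delta M t0 J (fun i => X i w).

(** Since [J] is symmetric, moving its inverse onto the basis vector exhibits each coordinate as a
    normalised sum of centred scalar statistics, the form that [Rintegral_sum_sqr] handles. *)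
Lemma Delta_coord (x : 'I_n -> 'cV[R]_d) j : Delta M t0 J x j 0 =
  (Num.sqrt n%:R)^-1 * \sum_(i < n) (dotp (x i) (invmx J *m delta_mx j 0)
    - dotp (ef_mu M t0) (invmx J *m delta_mx j 0)).
Proof.
have n0 : n%:R != 0 :> R by rewrite pnatr_eq0 -lt0n.
have s0 : Num.sqrt n%:R != 0 :> R by rewrite gt_eqF// sqrtr_gt0 ltr0n.
have ss : Num.sqrt n%:R * Num.sqrt n%:R = n%:R :> R by rewrite -expr2 sqr_sqrtr.
rewrite -dotp_delta dotpZr dotp_mulmxr (sym_sqrt_invmx_tr J_sqrt).
rewrite dotpBr dotpZr dotp_sumr big_split/= sumr_const card_ord.
rewrite mulNrn (dotpC (ef_mu _ _)) -[dotp _ (ef_mu _ _) *+ n]mulr_natl.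
under [in RHS]eq_bigr do rewrite dotpC.
by move: ss s0; set s := Num.sqrt _ => <- s0; field.
Qed.

Lemma measurable_Delta_coord j : measurable_fun setT (fun w => D w j 0).
Proof.
rewrite (_ : (fun w => D w j 0) = fun w => (Num.sqrt n%:R)^-1 *
  \sum_(i < n) (dotp (X i w) (invmx J *m delta_mx j 0)
    - dotp (ef_mu M t0) (invmx J *m delta_mx j 0))); last first.
  by apply/funext => w; rewrite /D Delta_coord.
apply: measurable_funM => //; apply: measurable_sum => i.
apply: measurable_funB => //.
by apply: (measurableT_comp (measurable_dotpl _)); exact: measurable_funP.
Qed.

(** Each coordinate has variance [<v j, F v j> = <e_j, e_j> = 1], where [v j] is [J^-1 e_j]. *)
Lemma Rintegral_Delta : P.-integrable setT (EFin \o (fun w => dotp (D w) (D w))) /\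
  \int[P]_w dotp (D w) (D w) = d%:R.
Proof.
pose v j : 'cV[R]_d := invmx J *m delta_mx j 0.
pose f j (x : 'cV[R]_d) := dotp x (v j) - dotp (ef_mu M t0) (v j).
have sf j : subexp (f j) by exact: subexp_dotpB.
have f0 j : expect M (f j) t0 = 0.
  rewrite expectD//; [|exact: subexp_dotp|exact: subexp_cst].
  by rewrite expect_dotp// expect_cst// ef_mu_mean// subrr.
have f1 j : expect M (fun x => f j x ^+ 2) t0 = 1.
  set m := dotp (ef_mu M t0) (v j).
  rewrite (@eq_expect _ _ _ _ (fun x => m ^+ 2 + (- (2 * m)) * dotp x (v j)
    + 1 * dotp x (v j) ^+ 2 + 0 * dotp x (v j) ^+ 3 + 0 * dotp x (v j) ^+ 4)).
    rewrite expect_poly4// expect_dotp// -ef_mu_mean// -/m.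
    have := ef_F_quad (v j) t0_in; rewrite expect_dotp// -ef_mu_mean// -/m.
    rewrite (dotp_sym_sqrt J_sqrt F_unit) dotp_delta mxE !eqxx /= => E.
    by rewrite [RHS]E; ring.
  by move=> x; rewrite /f -/m; ring.
have H j := Rintegral_sum_sqr t0_in X_indep X_density (sf j) (f0 j).
have sn : (Num.sqrt n%:R)^-1 ^+ 2 * n%:R = 1 :> R.
  by rewrite exprVn sqr_sqrtr// mulVf// pnatr_eq0 -lt0n.
have E : (fun w => dotp (D w) (D w)) = fun w => \sum_j ((Num.sqrt n%:R)^-1 ^+ 2 *
    (\sum_(i < n) f j (X i w)) ^+ 2).
  by apply/funext => w; apply: eq_bigr => j _; rewrite /D Delta_coord -expr2 exprMn.
have i1 j : P.-integrable setT (EFin \o (fun w => (Num.sqrt n%:R)^-1 ^+ 2 *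
    (\sum_(i < n) f j (X i w)) ^+ 2)).
  by apply: eq_integrable (integrableZl measurableT ((Num.sqrt n%:R)^-1 ^+ 2) (H j).1).
have [HA HB] := Rintegral_sum (index_enum 'I_d) i1.
rewrite E; split=> //; rewrite HB (eq_bigr (fun=> 1)).
  by rewrite sumr_const card_ord.
by move=> j _; rewrite RintegralZl ?(H j).2 ?f1 ?mulr1//; exact: (H j).1.
Qed.

Lemma measurable_Delta_tail (r : R) : measurable [set w | r < dotp (D w) (D w)].
Proof.
have m : measurable_fun setT (fun w => dotp (D w) (D w)).
  by apply: measurable_dotp => j; exact: measurable_Delta_coord.
have mE : measurable_fun setT (fun w => (dotp (D w) (D w))%:E) by exact/measurable_EFinP.
have := emeasurable_fun_o_infty measurableT mE r%:E.
by rewrite setTI; under eq_set do rewrite lte_fin.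
Qed.

Lemma Delta_tail (K : R) : 0 < K -> (0 < d)%N ->
  (P [set w | (K * d%:R < dotp (D w) (D w))%R] <= (K^-1)%:E)%E.
Proof.
move=> K0 d0; have [iD ID] := Rintegral_Delta.
have dR : 0 < d%:R :> R by rewrite ltr0n.
have Kd : 0 < K * d%:R by rewrite mulr_gt0.
have mD : measurable_fun setT (fun w => (dotp (D w) (D w))%:E).
  by case/integrableP : iD.
have := le_integral_abse P measurableT mD Kd.
rewrite setTI; under eq_integral do rewrite gee0_abs ?lee_fin ?dotp_ge0//.
have -> : (\int[P]_w (dotp (D w) (D w))%:E = d%:R%:E)%E.
  by rewrite -ID /Rintegral fineK//; apply: integrable_fin_num.
move=> H.
have {}H : (P [set w | ((K * d%:R)%:E <= `|(dotp (D w) (D w))%:E|)%E] <= (K^-1)%:E)%E.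
  rewrite -(@lee_pmul2l _ (K * d%:R)%:E)//.
  by apply: (le_trans H); rewrite -EFinM lee_fin mulrAC mulfV ?mul1r// gt_eqF.
apply: le_trans H; apply: le_measure; rewrite ?inE.
- exact: measurable_Delta_tail.
- have := emeasurable_fun_c_infty measurableT
    (measurableT_comp (@abse_measurable R setT) mD) (K * d%:R)%:E.
  by rewrite setTI.
- by move=> w /= /ltW; rewrite lee_fin => /le_trans; apply; exact: ler_norm.
Qed.

(** The posterior weight is later divided by the likelihood at [t0], which vanishes exactly when
    some [ef_h M (X i w)] does. *)
Lemma ef_h_null i : P [set w | ef_h M (X i w) = 0] = 0%E.
Proof.
have m0 : measurable [set x | ef_h M x = 0].
  have := @ef_h_measurable _ _ M measurableT [set 0].
  by rewrite setTI; apply; exact: measurable_set1.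
have := X_density i m0.
rewrite /distribution /pushforward => ->.
under eq_integral.
  move=> x /[!inE] /= h0.
  by rewrite /ef_density /exp_density h0 mul0r; over.
by rewrite integral0.
Qed.

End DeltaTail.

(** * Measurability of the posterior distance *)

Section Measurability.
Variables (R : realType) (d : nat) (M : expfam R d).
Local Notation Theta := (ef_Theta M).
Local Notation psi := (ef_psi M).

Lemma measurable_ef_Theta : measurable Theta.
Proof. by apply: open_cV_measurable; exact: (@ef_open _ _ M). Qed.

(** The quadratic remainder contributes [C * r] and the linear term the moment of [l1norm]. The
    estimate serves to show that [psi] has open sublevel sets. *)
Lemma moment1_locally_lipschitz t : Theta t ->
  exists2 r : R, 0 < r & exists2 C : R, 0 <= C & forall v, l1norm v <= r ->
    Theta (t + v) /\
    `|moment M (fun=> 1) (t + v) - moment M (fun=> 1) t| <= C * l1norm v.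
Proof.
move=> tT; have [r r0 [C C0 H]] := moment_expansion tT (subexp_cst d (1 : R)).
have sl := subexp_l1norm R d.
exists r => //; exists (C * r + moment M (@l1norm R d) t).
  rewrite addr_ge0 ?mulr_ge0// ?(ltW r0)// /moment Rintegral_ge0// => x _.
  by rewrite mulr_ge0 ?l1norm_ge0 ?ef_weight_ge0.
move=> v vr; have [tv Hv] := H v vr; split=> //.
set b := moment M (fun x => 1 * dotp x v) t in Hv.
set a := moment M _ (t + v) - _ in Hv *.
have -> : a = (a - b) + b by rewrite subrK.
rewrite (le_trans (ler_normD _ _))// mulrDl lerD//.
  apply: (le_trans Hv); rewrite expr2 mulrA ler_wpM2r ?l1norm_ge0//.
  by rewrite ler_wpM2l.
have sd : subexp (fun x : 'cV[R]_d => 1 * dotp x v).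
  by apply: subexpM; [exact: subexp_cst|exact: subexp_dotp].
rewrite /b /moment (le_trans (le_normr_Rintegral _ _))//.
  exact: integrable_subexp.
rewrite -RintegralZr//; last exact: integrable_subexp.
apply: le_Rintegral => //.
- by have /integrable_abse := integrable_subexp tT sd; apply: eq_integrable.
- by apply: eq_integrable (integrableZr measurableT (l1norm v) (integrable_subexp tT sl)).
- move=> x _; rewrite mul1r normrM (ger0_norm (ef_weight_ge0 _ _ _)).
  by rewrite mulrAC ler_wpM2r ?ef_weight_ge0// mulrC normr_dotp_l1norm.
Qed.

Lemma l1norm_le_ball (t u : 'cV[R]_d) (e : R) : ball t e u ->
  l1norm (u - t) <= d%:R * e.
Proof.
move=> [e0 tu]; rewrite /l1norm (le_trans (ler_sum _ (G := fun=> e) _))//.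
  move=> i _; rewrite !mxE distrC ltW//; exact: (tu i 0).
by rewrite sumr_const card_ord mulr_natl.
Qed.

Lemma measurable_psi : measurable_fun Theta psi.
Proof.
(* On [Theta] the condition [psi t < y] reads [moment M (fun=> 1) t < expR y]; open sets of this
   form make [psi] measurable. *)
have H (y : R) : open (Theta `&` [set t | moment M (fun=> 1) t < expR y]).
  rewrite openE => t [tT /= ty].
  have [r r0 [C C0 HC]] := moment1_locally_lipschitz tT.
  pose gap := expR y - moment M (fun=> 1) t.
  have gap0 : 0 < gap by rewrite subr_gt0.
  pose e := Num.min (r / (d%:R + 1)) (gap / ((C + 1) * (d%:R + 1))).
  have dp : 0 < d%:R + 1 :> R by rewrite ltr_wpDl.
  have Cp : 0 < C + 1 by rewrite ltr_wpDl.
  have e0 : 0 < e by rewrite lt_min !divr_gt0// mulr_gt0.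
  apply/nbhs_ballP; exists e => // u /l1norm_le_ball ut.
  have le1 : l1norm (u - t) <= r.
    apply: (le_trans ut); apply: (@le_trans _ _ ((d%:R + 1) * e)).
      by rewrite ler_wpM2r ?(ltW e0)// lerDl.
    by rewrite mulrC -ler_pdivlMr// ge_min lexx.
  have le2 : (C + 1) * l1norm (u - t) <= gap.
    apply: (@le_trans _ _ ((C + 1) * ((d%:R + 1) * e))).
      rewrite ler_wpM2l ?(ltW Cp)// (le_trans ut)// ler_wpM2r ?(ltW e0)// lerDl//.
    by rewrite mulrA mulrC -ler_pdivlMr ?mulr_gt0// ge_min lexx orbT.
  have [] := HC _ le1; rewrite subrKC => uT Hu; split=> //=.
  have ln0 := l1norm_ge0 (u - t).
  have [uv|uv] := eqVneq (l1norm (u - t)) 0.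
    move: Hu; rewrite uv mulr0 normr_le0 subr_eq0 => /eqP ->; exact: ty.
  have lnp : 0 < l1norm (u - t) by rewrite lt_neqAle eq_sym uv.
  have := le_trans (ler_norm _) Hu; rewrite /gap in le2; lra.
move=> mT; apply: (measurability _ (RGenInftyO.measurableE R)) => // _ [_ [y ->] <-].
apply: open_cV_measurable.
rewrite (_ : _ `&` _ = Theta `&` [set t | moment M (fun=> 1) t < expR y])//.
apply/seteqP; split=> t [tT]; rewrite /= in_itv/= => ty; split=> //=.
  by rewrite moment1// ltr_expR.
by move: ty; rewrite moment1// ltr_expR.
Qed.

End Measurability.

Section LocalMeasurability.
Context (disp : measure_display) (Omega : measurableType disp) (R : realType)
  (P : probability Omega R) (d : nat) (M : expfam R d) (t0 : 'cV[R]_d)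
  (J : 'M[R]_d) (n : nat) (X : 'I_n -> {RV P >-> 'cV[R]_d})
  (prior : 'cV[R]_d -> R).
Hypothesis F_unit : ef_F M t0 \in unitmx.
Hypothesis J_sqrt : is_sym_sqrt J (ef_F M t0).
Hypothesis n_gt0 : (0 < n)%N.
Hypothesis prior_density : is_prior M prior.

Local Notation U := (local_space M t0 J n).

Lemma of_localK (u : 'cV[R]_d) :
  Num.sqrt n%:R *: (J *m (of_local t0 J n u - t0)) = u.
Proof.
have s0 : Num.sqrt n%:R != 0 :> R by rewrite gt_eqF// sqrtr_gt0 ltr0n.
rewrite /of_local addrC addKr -scalemxAr scalerA mulfV// scale1r.
by rewrite mulKVmx//; exact: sym_sqrt_unitmx J_sqrt F_unit.
Qed.

Lemma local_spaceE : U = of_local t0 J n @^-1` ef_Theta M.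
Proof.
have s0 : Num.sqrt n%:R != 0 :> R by rewrite gt_eqF// sqrtr_gt0 ltr0n.
apply/seteqP; split=> [_ [t tT <-]|u uT].
  rewrite /= /of_local -scalemxAr mulKmx; last exact: sym_sqrt_unitmx J_sqrt F_unit.
  by rewrite scalerA mulVf// scale1r addrC subrK.
by exists (of_local t0 J n u) => //; rewrite of_localK.
Qed.

Lemma of_local_coord (u : 'cV[R]_d) i : of_local t0 J n u i 0 =
  t0 i 0 + (Num.sqrt n%:R)^-1 * \sum_k invmx J i k * u k 0.
Proof. by rewrite !mxE. Qed.

Lemma measurable_of_local : measurable_fun setT (of_local t0 J n).
Proof.
apply/measurable_fun_cVP => i.
rewrite (_ : _ \o _ = fun u : 'cV[R]_d =>
  t0 i 0 + (Num.sqrt n%:R)^-1 * \sum_k invmx J i k * u k 0).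
  apply: measurable_funD => //; apply: measurable_funM => //.
  apply: measurable_sum => k; apply: measurable_funM => //.
  exact: measurable_cV_coord.
by apply/funext => u; rewrite /= /cV_coord of_local_coord.
Qed.

Lemma measurable_local_space : measurable U.
Proof.
rewrite local_spaceE -[X in measurable X]setTI; apply: measurable_of_local => //.
exact: measurable_ef_Theta.
Qed.

Let D : set (Omega * 'cV[R]_d) := snd @^-1` U.

Let mD : measurable D.
Proof.
rewrite /D -[X in measurable X]setTI.
by apply: measurable_snd => //; exact: measurable_local_space.
Qed.

Let measurable_theta (g : 'cV[R]_d -> R) : measurable_fun (ef_Theta M) g ->
  measurable_fun D (fun z => g (of_local t0 J n z.2)).
Proof.
move=> mg; apply: (measurable_comp (@measurable_ef_Theta _ _ M) _ mg).
  by move=> _ [z /= zD <-]; move: zD; rewrite /D /= local_spaceE.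
apply: measurable_funTS; apply: measurableT_comp => //.
exact: measurable_of_local.
Qed.

Let measurable_X i j : measurable_fun setT (fun z : Omega * 'cV[R]_d => X i z.1 j 0).
Proof.
by apply: (measurableT_comp (measurable_cV_coord j)); exact: measurableT_comp.
Qed.

Lemma measurable_post_weight : measurable_fun D
  (fun z => post_weight M prior t0 J (fun i => X i z.1) z.2).
Proof.
have [mp _] := prior_density.
apply: measurable_funM; first exact: measurable_theta.
apply: measurable_prod => i _; apply: measurable_funM.
  apply: measurable_funTS.
  by apply: (measurableT_comp (@ef_h_measurable _ _ M)); exact: measurableT_comp.
apply: measurableT_comp => //; apply: measurable_funB.
  apply: measurable_dotp => j; first exact: measurable_funTS.
  apply: (@measurable_theta (fun t => t j 0)); apply: measurable_funTS.
  exact: measurable_cV_coord.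
by apply: measurable_theta; exact: measurable_psi.
Qed.

Let measurable_sect (g : Omega * 'cV[R]_d -> R) : measurable_fun D g ->
  (forall z, D z -> 0 <= g z) ->
  measurable_fun setT (fun w => \int[lebesgue_cV R d]_(u in U) (g (w, u))%:E)%E.
Proof.
move=> mg g0.
have := @measurable_fun_fubini_tonelli_F _ _ _ _ R (lebesgue_cV R d)
  ((EFin \o g) \_ D).
have mgD : measurable_fun setT ((EFin \o g) \_ D).
  by apply/(measurable_restrictT _ mD); exact/measurable_EFinP.
have gD0 z : (0 <= ((EFin \o g) \_ D) z)%E.
  by rewrite patchE; case: ifPn => // /[!inE] zD; rewrite lee_fin g0.
move=> /(_ mgD gD0); congr measurable_fun; apply/funext => w.
rewrite /fubini_F [RHS]integral_mkcond; apply: eq_integral => u _.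
by rewrite !patchE /D; congr (if _ then _ else _); apply/idP/idP; rewrite !inE.
Qed.

Lemma post_weight_ge0 (x : 'I_n -> 'cV[R]_d) u : U u ->
  0 <= post_weight M prior t0 J x u.
Proof.
have [_ p0] := prior_density; rewrite local_spaceE /= => uT.
by rewrite mulr_ge0 ?p0// prodr_ge0// => i _; exact: ef_density_ge0.
Qed.

Lemma measurable_posterior_distance : measurable_fun setT (fun w =>
  \int[lebesgue_cV R d]_(u in U)
    (`|local_posterior M prior t0 J (fun i => X i w) u -
       gauss_density (Delta M t0 J (fun i => X i w)) 1%:M u|)%:E)%E.
Proof.
pose g (z : Omega * 'cV[R]_d) : R := `|local_posterior M prior t0 J (fun i => X i z.1) z.2 -
       gauss_density (Delta M t0 J (fun i => X i z.1)) 1%:M z.2|.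
apply: (@measurable_sect g) => [|z _]; last exact: normr_ge0.
apply: measurableT_comp => //; apply: measurable_funB.
  apply: measurable_funM; first exact: measurable_post_weight.
  apply: measurable_funTS.
  pose W w := \int[lebesgue_cV R d]_(v in U) post_weight M prior t0 J (fun i => X i w) v.
  (* On nonnegative reals, 0 included, the inverse is the power with exponent -1, for which
     [measurable_powR] applies. *)
  rewrite (_ : (fun z => _) = (fun w => powR (W w) (-1)) \o fst); last first.
    apply/funext => z /=; rewrite powR_inv1//.
    by apply: Rintegral_ge0 => v; exact: post_weight_ge0.
  apply: measurableT_comp => //.
  apply: (@measurableT_comp _ _ _ _ _ _ (fun y => powR y (-1))).
    exact: measurable_powR.
  apply: measurableT_comp; first exact: fine_measurable.
  apply: (@measurable_sect (fun z => post_weight M prior t0 J (fun i => X i z.1) z.2)).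
    exact: measurable_post_weight.
  by move=> z zD; exact: post_weight_ge0.
apply: measurable_funTS; rewrite /gauss_density.
apply: measurable_funM => //; apply: measurableT_comp => //.
apply: measurableT_comp => //; apply: measurable_funM => //.
rewrite invmx1; under eq_fun do rewrite mul1mx.
have m i : measurable_fun setT (fun z : Omega * 'cV[R]_d =>
    (z.2 - Delta M t0 J (fun i => X i z.1)) i 0).
  rewrite (_ : (fun z => _) = (fun z : Omega * 'cV[R]_d =>
    z.2 i 0 - Delta M t0 J (fun i => X i z.1) i 0)).
    apply: measurable_funB.
      by apply: (measurableT_comp (@measurable_cV_coord R d i)).
    by apply: (measurableT_comp (measurable_Delta_coord X J_sqrt n_gt0 i)).
  by apply/funext => z; rewrite !mxE.
by apply: measurable_dotp.
Qed.

End LocalMeasurability.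

(** * Comparison with the Gaussian density *)

Section NormalizedDistance.
Context (disp : measure_display) (T : measurableType disp) (R : realType)
  (mu : {measure set T -> \bar R}) (f phi : T -> R) (eta : R).
Hypothesis mf : measurable_fun setT f.
Hypothesis mphi : measurable_fun setT phi.
Hypothesis f_ge0 : forall x, 0 <= f x.
Hypothesis phi_ge0 : forall x, 0 <= phi x.
Hypothesis phi1 : (\int[mu]_x (phi x)%:E = 1)%E.
Hypothesis dist_le : (\int[mu]_x (`|f x - phi x|)%:E <= eta%:E)%E.
Hypothesis eta_lt1 : eta < 1.

(** With [F] the integral of [f], write [f / F - phi = (f - phi) + (1 - F) / F * f]. The second term
    has L1 norm [|1 - F|], itself at most the distance of [f] from [phi]; this explains the factor
    2, and [eta < 1] gives [F > 0]. *)
Lemma normalized_distance_le : [/\ mu.-integrable setT (EFin \o f),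
  0 < \int[mu]_x f x &
  (\int[mu]_x (`|f x / (\int[mu]_y f y)%R - phi x|)%:E <= (2 * eta)%:E)%E].
Proof.
have iphi : mu.-integrable setT (EFin \o phi).
  apply/integrableP; split; first exact/measurable_EFinP.
  under eq_integral do rewrite /= ger0_norm//.
  by rewrite phi1 ltry.
have idist : mu.-integrable setT (EFin \o (fun x => f x - phi x)).
  apply/integrableP; split; first exact/measurable_EFinP/measurable_funB.
  by apply: le_lt_trans dist_le _; rewrite ltry.
have iadist : mu.-integrable setT (EFin \o (fun x => `|f x - phi x|)).
  by have /integrable_abse := idist; apply: eq_integrable.
have if_ : mu.-integrable setT (EFin \o f).
  apply: eq_integrable (integrableD measurableT idist iphi) => //.
  by move=> x _; rewrite /= -EFinD subrK.
set F := \int[mu]_y f y.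
have dist : \int[mu]_x `|f x - phi x| <= eta.
  rewrite -lee_fin; apply: le_trans dist_le.
  by rewrite /Rintegral fineK//; exact: integrable_fin_num.
have Fphi : `|F - 1| <= eta.
  have -> : F - 1 = \int[mu]_x (f x - phi x).
    by rewrite RintegralB// [X in _ = _ - X]/Rintegral phi1.
  exact: le_trans (le_normr_Rintegral _ _) dist.
have F0 : 0 < F by move: Fphi; rewrite ler_norml => /andP[]; move: eta_lt1; lra.
split=> //.
have ifF : mu.-integrable setT (EFin \o (fun x => `|1 - F| / F * f x)).
  by apply: eq_integrable (integrableZl measurableT (`|1 - F| / F) if_).
have -> : (2 * eta)%:E = (eta%:E + eta%:E)%E by rewrite -EFinD; congr EFin; ring.
apply: (@le_trans _ _ (\int[mu]_x ((`|f x - phi x|)%:E + (`|1 - F| / F * f x)%:E))%E).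
  apply: ge0_le_integral => //.
  - by apply/measurable_EFinP/measurableT_comp => //; apply: measurable_funB => //;
    exact: measurable_funM.
  - apply: emeasurable_funD; first by case/integrableP : iadist.
    by case/integrableP : ifF.
  - move=> x _; rewrite -EFinD lee_fin.
    have -> : f x / F - phi x = (f x - phi x) + (1 - F) / F * f x.
      by field; rewrite gt_eqF.
    rewrite (le_trans (ler_normD _ _))// lerD2l !normrM (ger0_norm (f_ge0 x)).
    by rewrite normfV (ger0_norm (ltW F0)).
rewrite integralD//; apply: leeD.
  by rewrite (le_trans _ dist_le).
have -> : (\int[mu]_x (`|1 - F| / F * f x)%:E = (\int[mu]_x (`|1 - F| / F * f x)%R)%:E)%E.
  by rewrite /Rintegral fineK//; exact: integrable_fin_num.
by rewrite RintegralZl// -/F lee_fin divfK ?gt_eqF// distrC.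
Qed.

End NormalizedDistance.

Lemma subexp_ef_V (R : realType) (d : nat) (M : expfam R d) (J : 'M[R]_d)
    (k : nat) (a t : 'cV[R]_d) : subexp (fun y => dotp a (ef_V M J t y) ^+ k).
Proof.
pose b := (invmx J)^T *m a.
rewrite (_ : (fun y => _) = fun y => (dotp y b - dotp (ef_mean M t) b) ^+ k).
  by apply: subexpX; exact: subexp_dotpB.
by apply/funext => y; rewrite /ef_V dotp_mulmxr dotpBr !(dotpC _ b).
Qed.

(** * The local log-likelihood ratio and the unnormalised comparison *)

Section LocalLikelihood.
Variables (R : realType) (d : nat) (M : expfam R d) (t0 : 'cV[R]_d)
  (J : 'M[R]_d) (n : nat) (x : 'I_n -> 'cV[R]_d) (prior : 'cV[R]_d -> R).
Hypothesis t0_in : ef_Theta M t0.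
Hypothesis F_unit : ef_F M t0 \in unitmx.
Hypothesis J_sqrt : is_sym_sqrt J (ef_F M t0).
Hypothesis n_gt0 : (0 < n)%N.
Hypothesis d_gt0 : (0 < d)%N.
Hypothesis x_support : forall i, 0 < ef_h M (x i).
Hypothesis prior_density : is_prior M prior.
Hypothesis prior0 : 0 < prior t0.

Local Notation psi := (ef_psi M).
Local Notation mu := (ef_mu M t0).
Local Notation theta := (of_local t0 J n).
Local Notation U := (local_space M t0 J n).
Local Notation D := (Delta M t0 J x).
Implicit Types u : 'cV[R]_d.

Let sqrtn : R := Num.sqrt n%:R.
Let sqrtn_gt0 : 0 < sqrtn. Proof. by rewrite sqrtr_gt0 ltr0n. Qed.
Let sqrtn2 : sqrtn ^+ 2 = n%:R. Proof. by rewrite sqr_sqrtr. Qed.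

Definition llr u : R :=
  dotp D u - n%:R * (psi (theta u) - psi t0 - dotp mu (theta u - t0)).

Let step u : 'cV[R]_d := sqrtn^-1 *: (invmx J *m u).

Let thetaB u : theta u - t0 = step u.
Proof. by rewrite /of_local addrC addKr. Qed.

Let thetaE u : theta u = t0 + step u. Proof. by []. Qed.

Let dotp_Delta u : dotp D u = \sum_(i < n) dotp (x i) (step u) - n%:R * dotp mu (step u).
Proof.
rewrite /Delta -/sqrtn dotpZl dotpC dotp_mulmxr (sym_sqrt_invmx_tr J_sqrt).
rewrite dotpBr dotpZr dotp_sumr /step dotpZr (dotpC mu).
rewrite [in RHS](eq_bigr (fun i => sqrtn^-1 * dotp (invmx J *m u) (x i))); last first.
  by move=> i _; rewrite dotpZr dotpC.
by rewrite -mulr_sumr -sqrtn2; field; rewrite gt_eqF.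
Qed.

Let lik0 : R := \prod_(i < n) ef_density M t0 (x i).

Let lik0_gt0 : 0 < lik0.
Proof.
by apply: prodr_gt0 => i _; rewrite /ef_density /exp_density mulr_gt0 ?expR_gt0.
Qed.

Lemma post_weightE u : post_weight M prior t0 J x u =
  prior t0 * lik0 * (prior (theta u) / prior t0 * expR (llr u)).
Proof.
rewrite /post_weight.
have -> : \prod_(i < n) ef_density M (theta u) (x i) = lik0 * expR (llr u).
  have -> : llr u = \sum_(i < n) (dotp (x i) (step u) - (psi (theta u) - psi t0)).
    rewrite /llr dotp_Delta thetaB big_split/= sumr_const card_ord.
    by rewrite -[X in _ = _ + X]mulr_natl; ring.
  rewrite expR_sum -big_split/=; apply: eq_bigr => i _.
  rewrite /ef_density /exp_density -mulrA -expRD thetaE dotpDr; congr (_ * expR _).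
  by ring.
by field; rewrite gt_eqF.
Qed.


Section Ellipsoid.
Variables (c lam : R).
Hypothesis c_gt0 : 0 < c.
Hypothesis ball_in : forall u, enorm u ^+ 2 <= c * d%:R -> ef_Theta M (theta u).
Hypothesis lam_bound : forall a t, enorm a = 1 -> ef_ellipsoid M t0 J n c t ->
  6^-1 * (Num.sqrt (c * d%:R / n%:R) *
            `|expect M (fun y => dotp a (ef_V M J t0 y) ^+ 3) t0| +
          c * d%:R / n%:R * expect M (fun y => dotp a (ef_V M J t y) ^+ 4) t)
  <= lam.

Let central_momentV k t u : ef_Theta M t -> enorm u != 0 ->
  central_moment M k t (step u) = (enorm u / sqrtn) ^+ k *
    expect M (fun y => dotp ((enorm u)^-1 *: u) (ef_V M J t y) ^+ k) t.
Proof.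
move=> tT u0; rewrite -expectZ//; last exact: subexp_ef_V.
apply: eq_expect => y.
rewrite -exprMn; congr (_ ^+ k).
rewrite /ef_V dotp_mulmxr (sym_sqrt_invmx_tr J_sqrt) -scalemxAr dotpZl /step dotpZr.
by rewrite dotpC; field; rewrite u0 gt_eqF.
Qed.

Lemma llr_quadratic u : enorm u ^+ 2 <= c * d%:R ->
  `|llr u - (dotp D u - enorm u ^+ 2 / 2)| <= lam * enorm u ^+ 2.
Proof.
move=> uc.
have n0 : 0 < n%:R :> R by rewrite ltr0n.
have -> : llr u - (dotp D u - enorm u ^+ 2 / 2) =
    - (n%:R * (psi (t0 + step u) - psi t0 - dotp mu (step u)
       - dotp (step u) (ef_F M t0 *m step u) / 2)).
  have -> : dotp (step u) (ef_F M t0 *m step u) = n%:R^-1 * enorm u ^+ 2.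
    rewrite /step -scalemxAr dotpZl dotpZr (dotp_sym_sqrt J_sqrt F_unit).
    by rewrite sqr_enorm mulrA -expr2 exprVn sqrtn2.
  by rewrite /llr thetaB; field; rewrite gt_eqF.
rewrite normrN normrM (ger0_norm (ltW n0)).
have [u0|u0] := eqVneq (enorm u) 0.
  rewrite (enorm_eq0 u0) /step mulmx0 scaler0 addr0 mulmx0 !dotp0r mul0r !subr0 subrr normr0.
  by rewrite mulr0 /enorm dotp0r sqrtr0 expr0n mulr0.
have up : 0 < enorm u by rewrite lt_neqAle eq_sym u0 enorm_ge0.
set Q : R := c * d%:R / n%:R.
have Q0 : 0 < Q by rewrite divr_gt0// mulr_gt0// ltr0n.
set r := enorm u / sqrtn.
have r0 : 0 < r by rewrite divr_gt0.
have r2 : r ^+ 2 <= Q by rewrite expr_div_n sqrtn2 ler_pM2r// invr_gt0.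
have rQ : r <= Num.sqrt Q by rewrite -(ger0_norm (ltW r0)) -sqrtr_sqr ler_wsqrtr.
pose a := (enorm u)^-1 *: u.
have a1 : enorm a = 1.
  by rewrite enormZ ger0_norm ?invr_ge0 ?enorm_ge0// mulVf.
pose e3 : R := `|expect M (fun y => dotp a (ef_V M J t0 y) ^+ 3) t0|.
(* The largest fourth moment that [lam_bound] leaves room for, so that [sqrt Q * e3 + Q * b4] equals
   [6 * lam] exactly. *)
pose b4 := (6 * lam - Num.sqrt Q * e3) / Q.
have seg (s : R) : 0 <= s <= 1 -> ef_ellipsoid M t0 J n c (t0 + s *: step u).
  move=> /andP[s0 s1].
  have su : s *: step u = step (s *: u) by rewrite /step -scalemxAr !scalerA mulrC.
  have nsu : enorm (s *: u) ^+ 2 <= c * d%:R.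
    apply: le_trans uc; rewrite enormZ exprMn real_normK ?num_real//.
    by rewrite ler_piMl ?sqr_ge0// exprn_ile1.
  split; first by rewrite su -thetaE; exact: ball_in.
  rewrite su addrC addKr /step -scalemxAr mulKVmx; last exact: sym_sqrt_unitmx J_sqrt F_unit.
  rewrite enormZ exprMn real_normK ?num_real// exprVn sqrtn2 mulrC.
  by rewrite ler_pM2r// invr_gt0.
have b4P (s : R) : 0 <= s <= 1 ->
    expect M (fun y => dotp a (ef_V M J (t0 + s *: step u) y) ^+ 4) (t0 + s *: step u) <= b4.
  move=> s01; have := lam_bound a1 (seg s s01).
  by rewrite -/Q -/e3 /b4 ler_pdivlMr//; lra.
have b40 : 0 <= b4.
  have z01 : 0 <= (0 : R) <= 1 by rewrite lexx ler01.
  apply: le_trans (b4P 0 z01); apply: expect_ge0 => [|y]; first exact: (seg 0 z01).1.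
  by rewrite -[4%N]/(2 * 2)%N exprM sqr_ge0.
have := @psi_taylor _ _ M t0 (step u) (r ^+ 4 * b4) (fun s s01 => (seg s s01).1).
have H4 (s : R) : 0 <= s <= 1 -> central_moment M 4 (t0 + s *: step u) (step u) <= r ^+ 4 * b4.
  move=> s01; have [tT _] := seg s s01.
  by rewrite central_momentV// ler_wpM2l ?b4P// exprn_ge0// ltW.
move=> /(_ H4); rewrite central_momentV// -/r -/a normrM -/e3.
rewrite (ger0_norm (exprn_ge0 _ (ltW r0))) => H.
apply: (le_trans (ler_wpM2l (ltW n0) H)).
have -> : enorm u ^+ 2 = n%:R * r ^+ 2.
  by rewrite expr_div_n sqrtn2 mulrC divfK// gt_eqF.
rewrite [leRHS]mulrCA ler_pM2l//.
(* One factor [r ^+ 2] is kept and becomes [enorm u ^+ 2 / n]; in the remaining factor [r] is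
   replaced by its maximum [sqrt Q] on the ellipsoid. *)
have -> : r ^+ 3 * e3 / 6 + r ^+ 4 * b4 / 12 = r ^+ 2 * (r * e3 / 6 + r ^+ 2 * b4 / 12) by field.
rewrite mulrC ler_wpM2r ?sqr_ge0//.
have h1 : r * e3 <= Num.sqrt Q * e3 by rewrite ler_wpM2r// normr_ge0.
have h2 : r ^+ 2 * b4 <= Q * b4 by rewrite ler_wpM2r.
have h3 : Q * b4 = 6 * lam - Num.sqrt Q * e3 by rewrite /b4 mulrC divfK// gt_eqF.
have h4 : 0 <= Q * b4 by rewrite mulr_ge0// ltW.
by lra.
Qed.

Variables (K C eps kap : R).
Hypothesis c_ge256 : 256 <= c.
Hypothesis c_geK : 64 * K <= c.
Hypothesis D_bound : dotp D D <= K * d%:R.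
Hypothesis lam_le : lam <= 8^-1.
Hypothesis eps_ge : lam * (c * d%:R) + kap <= eps.
Hypothesis prior_local : forall u, enorm u ^+ 2 <= c * d%:R ->
  0 < prior (theta u) /\ `|ln (prior (theta u)) - ln (prior t0)| <= kap.
Hypothesis prior_sup : forall t, ef_Theta M t ->
  prior t <= prior t0 * expR (C * d%:R).

Let rho : R := Num.sqrt (c * d%:R).
Let cd_gt0 : 0 < c * d%:R. Proof. by rewrite mulr_gt0// ltr0n. Qed.
Let rho_gt0 : 0 < rho. Proof. by rewrite sqrtr_gt0. Qed.
Let rho2 : rho ^+ 2 = c * d%:R. Proof. by rewrite sqr_sqrtr// ltW. Qed.

(** The 64 in [c_geK] is the square of the 8 here. *)
Let enorm_D : enorm D <= rho / 8.
Proof.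
rewrite -(@ler_pXn2r _ 2) ?nnegrE ?enorm_ge0 ?divr_ge0 ?(ltW rho_gt0)//.
rewrite sqr_enorm expr_div_n rho2 (le_trans D_bound)//.
rewrite ler_pdivlMr; last by rewrite exprn_gt0.
by rewrite mulrAC ler_wpM2r// mulrC (_ : 8 ^+ 2 = 64)//; ring.
Qed.

Let gauss_tail u : rho <= enorm u ->
  dotp D u - enorm u ^+ 2 / 2 <= - (rho * enorm u / 4).
Proof.
move=> ru; have h1 := dotp_le_enorm D u; have h2 := ler_wpM2r (enorm_ge0 u) enorm_D.
have h3 := ler_wpM2r (enorm_ge0 u) ru.
by have h4 := mulr_ge0 (ltW rho_gt0) (enorm_ge0 u); rewrite expr2; lra.
Qed.

Let llr_tail u : U u -> rho <= enorm u -> llr u <= - (rho * enorm u / 4).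
Proof.
rewrite (local_spaceE F_unit J_sqrt n_gt0) /= => uT ru.
have up : 0 < enorm u by exact: lt_le_trans ru.
pose s := rho / enorm u.
have s01 : 0 <= s <= 1.
  by rewrite divr_ge0 ?(ltW rho_gt0) ?(ltW up)//= ler_pdivrMr// mul1r.
have s0 : 0 < s by rewrite divr_gt0.
have nsu : enorm (s *: u) = rho.
  by rewrite enormZ ger0_norm ?(ltW s0)// divfK// gt_eqF.
have su : step (s *: u) = s *: step u by rewrite /step -scalemxAr !scalerA mulrC.
(* [psi] is convex, and [llr] is concave with value 0 at the origin; [s *: u] is the point of the
   segment on the sphere of radius [rho]. *)
have concave : s * llr u <= llr (s *: u).
  have := psi_convex t0_in uT s01; rewrite thetaB => cvx.
  rewrite /llr !thetaB su !dotpZr (thetaE (s *: u)) su.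
  have n0 : 0 <= n%:R :> R by [].
  have := ler_wpM2l n0 cvx; set A := psi _; lra.
have := @llr_quadratic (s *: u); rewrite nsu rho2 lexx => /(_ isT).
rewrite ler_norml => /andP[_ quad].
have h1 := dotp_le_enorm D (s *: u); rewrite nsu in h1.
have h2 := ler_wpM2r (ltW rho_gt0) enorm_D.
have h3 := ler_wpM2r (ltW cd_gt0) lam_le.
have hr : rho * rho = c * d%:R by rewrite -rho2 expr2.
(* In units of [rho ^+ 2]: 1/8 from [Delta], 1/8 from [lam], and -1/2 from the quadratic term.
   Dividing by [s] then yields the linear decay. *)
have bound : llr (s *: u) <= - (c * d%:R / 4) by lra.
rewrite -(ler_pM2l s0) (le_trans concave)// (le_trans bound)// -rho2.
by rewrite /s expr2 le_eqVlt; apply/orP; left; apply/eqP; field; rewrite gt_eqF.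
Qed.

(** Half of the exponent gives [c * d / 8], as [rho <= enorm u]. The other half is at least
    [2 * l1norm u], as [16 * sqrt d <= rho] when [c >= 256]. Finally
    [expR (- 2 a) <= 1 / (1 + a ^ 2)] for each coordinate modulus [a]. *)
Let tail_exp u : rho <= enorm u ->
  expR (- (rho * enorm u / 4)) <= expR (- (c * d%:R / 8)) * cauchy_prod u.
Proof.
move=> ru.
have h1 : rho * rho <= rho * enorm u by rewrite ler_wpM2l// ltW.
have h2 : 16 * l1norm u <= rho * enorm u.
  apply: (@le_trans _ _ (16 * (Num.sqrt d%:R * enorm u))).
    by rewrite ler_wpM2l// l1norm_le_enorm.
  rewrite mulrA ler_wpM2r ?enorm_ge0// /rho sqrtrM; last exact: ltW.
  rewrite ler_wpM2r ?sqrtr_ge0// -(@ler_pXn2r _ 2) ?nnegrE ?sqrtr_ge0//.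
  by rewrite sqr_sqrtr ?(ltW c_gt0)// (le_trans _ c_ge256)// (_ : 16 ^+ 2 = 256)//; ring.
have hr : rho * rho = c * d%:R by rewrite -rho2 expr2.
apply: (@le_trans _ _ (expR (- (c * d%:R / 8) + - (2 * l1norm u)))).
  by rewrite ler_expR; lra.
rewrite expRD ler_wpM2l ?expR_ge0// mulr_sumr -sumrN expR_sum.
apply: ler_prod => i _; rewrite expR_ge0/= expRN lef_pV2 ?posrE ?expR_gt0//.
rewrite /oneDsqr -real_normK ?num_real// expRM_natl.
have := expR_ge1Dx `|u i 0|; have := normr_ge0 (u i 0).
set a := `|u i 0| => a0 ea.
have : (1 + a) ^+ 2 <= expR a ^+ 2.
  by rewrite ler_pXn2r// nnegrE ?expR_ge0// addr_ge0.
by apply: le_trans; rewrite sqrrD expr1n mul1r lerD2r lerDl mulrn_wge0.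
Qed.

Let G : R := Num.sqrt ((2 * pi) ^+ d) * expR (dotp D D / 2).

Let G_ge1 : 1 <= G.
Proof.
rewrite -[1]mulr1 ler_pM//; last by rewrite expR_ge1// divr_ge0// dotp_ge0.
rewrite -[leLHS]sqrtr1 ler_wsqrtr// exprn_ege1//.
by have := @pi_ge2 R; lra.
Qed.

Let G_gt0 : 0 < G. Proof. exact: lt_le_trans G_ge1. Qed.

Let gauss_densityE u :
  gauss_density D 1%:M u = expR (dotp D u - enorm u ^+ 2 / 2) / G.
Proof.
rewrite /gauss_density invmx1 mul1mx det1 mulr1 /G invfM mulrCA mulrC.
congr (_ * _); rewrite -expRN -expRD; congr expR.
by rewrite sqr_enorm !dotpBr !dotpBl (dotpC u D); field.
Qed.

Let scale : R := prior t0 * lik0 * G.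

Let scale_gt0 : 0 < scale.
Proof. exact: mulr_gt0 (mulr_gt0 prior0 lik0_gt0) G_gt0. Qed.

(** Scaled so that it should be close to the Gaussian density itself, and extended by 0 outside [U]
    so that all integrals run over the whole space. *)
Let f : 'cV[R]_d -> R := (fun u => post_weight M prior t0 J x u / scale) \_ U.

Let fE u : U u -> f u = prior (theta u) / prior t0 * expR (llr u) / G.
Proof.
move=> uU; rewrite /f patchE mem_set// post_weightE /scale.
by field; rewrite !gt_eqF.
Qed.

Let f_ge0 u : 0 <= f u.
Proof.
rewrite /f patchE; case: ifPn => // /[!inE] uU.
by rewrite divr_ge0 ?(ltW scale_gt0)// post_weight_ge0.
Qed.

(** [llr_quadratic] on a vector of length [rho] bounds an absolute value by this product. *)
Let lam_ge0 : 0 <= lam * (c * d%:R).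
Proof.
have := llr_quadratic (u := rho *: delta_mx (Ordinal d_gt0) 0).
have -> : enorm (rho *: delta_mx (Ordinal d_gt0) 0 : 'cV[R]_d) = rho.
  rewrite enormZ ger0_norm ?(ltW rho_gt0)// /enorm dotp_delta mxE !eqxx.
  by rewrite sqrtr1 mulr1.
by rewrite rho2 lexx => /(_ isT); exact: le_trans.
Qed.

Let eps_ge0 : 0 <= eps.
Proof.
apply: le_trans eps_ge; rewrite addr_ge0//.
have := prior_local (u := 0); rewrite /enorm dotp0r sqrtr0 expr0n (ltW cd_gt0).
by case=> // _; exact: le_trans.
Qed.

(** Inside the ball, [f] is the Gaussian density times the exponential of the prior error [b] plus
    the likelihood error [a]; outside, both functions lie below the Cauchy majorant. Adding the two
    bounds gives one valid everywhere, which is integrated without splitting the domain. *)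
Let f_dist u : `|f u - gauss_density D 1%:M u| <=
  (expR eps - 1) * gauss_density D 1%:M u +
  (expR (C * d%:R) + 1) * expR (- (c * d%:R / 8)) * cauchy_prod u.
Proof.
have g0 := gauss_density_ge0 D u; have cp0 := cauchy_prod_ge0 u.
have T0 : 0 <= (expR (C * d%:R) + 1) * expR (- (c * d%:R / 8)) * cauchy_prod u.
  by rewrite !mulr_ge0// ?expR_ge0// addr_ge0// expR_ge0.
have [ur|ur] := leP (enorm u) rho.
  have uc : enorm u ^+ 2 <= c * d%:R.
    by rewrite -rho2 ler_pXn2r// ?nnegrE ?enorm_ge0// ltW.
  have uU : U u by rewrite (local_spaceE F_unit J_sqrt n_gt0); exact: ball_in.
  have [p0 pk] := prior_local uc.
  have lq := llr_quadratic uc.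
  set b := ln (prior (theta u)) - ln (prior t0) in pk.
  set a := llr u - _ in lq.
  have -> : f u = gauss_density D 1%:M u * expR (b + a).
    have pb : prior (theta u) / prior t0 = expR b.
      by rewrite /b expRB !lnK ?posrE.
    rewrite fE// pb gauss_densityE [RHS]mulrAC -expRD -expRD.
    by congr (expR _ / _); rewrite /a; ring.
  have abe : `|b + a| <= eps.
    rewrite (le_trans (ler_normD _ _))// (le_trans _ eps_ge)// addrC lerD//.
    apply: (le_trans lq); have [l0|l0] := leP 0 lam; first by rewrite ler_wpM2l.
    by rewrite (le_trans _ lam_ge0)// mulr_le0_ge0 ?sqr_ge0// ltW.
  rewrite -[X in _ - X]mulr1 -mulrBr normrM (ger0_norm g0) mulrC.
  rewrite -[leLHS]addr0 lerD// ler_wpM2r//.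
  rewrite ler_norml; apply/andP; split; last first.
    by rewrite lerD2r ler_expR (le_trans (ler_norm _)).
  have : - eps <= b + a by move: abe; rewrite ler_norml => /andP[].
  (* The lower side uses [expR (- eps) >= 1 - eps >= 2 - expR eps]. *)
  rewrite -ler_expR => h; have := expR_ge1Dx eps; have := expR_ge1Dx (- eps).
  by lra.
have ru := ltW ur.
have te := tail_exp ru.
set e8 := expR (- (c * d%:R / 8)) in T0 te *; have e80 : 0 <= e8 by exact: expR_ge0.
have gt : gauss_density D 1%:M u <= e8 * cauchy_prod u.
  rewrite gauss_densityE ler_pdivrMr//; apply: (@le_trans _ _ (expR (- (rho * enorm u / 4)))).
    by rewrite ler_expR; exact: gauss_tail.
  by rewrite (le_trans te)// ler_peMr// mulr_ge0.
have ft : f u <= expR (C * d%:R) * e8 * cauchy_prod u.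
  have [uU|uU] := pselect (U u); last first.
    by rewrite /f patchE memNset// !mulr_ge0 ?expR_ge0.
  have uT : ef_Theta M (theta u) by move: uU; rewrite (local_spaceE F_unit J_sqrt n_gt0).
  rewrite fE// ler_pdivrMr// -![in leRHS]mulrA.
  have pw : prior (theta u) / prior t0 <= expR (C * d%:R).
    by rewrite ler_pdivrMr// mulrC prior_sup.
  have [_ pr0] := prior_density.
  apply: ler_pM => //; first by rewrite divr_ge0 ?pr0// ltW.
  apply: (@le_trans _ _ (expR (- (rho * enorm u / 4)))).
    by rewrite ler_expR; exact: llr_tail.
  by rewrite mulrA (le_trans te)// ler_peMr// mulr_ge0.
have e1 := expR_ge1 eps_ge0.
apply: (@le_trans _ _ (f u + gauss_density D 1%:M u)).
  by have f0 := f_ge0 u; rewrite ler_norml; apply/andP; split; lra.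
rewrite -[leLHS]add0r lerD//; first by rewrite mulr_ge0// subr_ge0.
rewrite -mulrA mulrDl mul1r lerD//; by rewrite mulrA.
Qed.

Hypothesis mpw : measurable_fun U (post_weight M prior t0 J x).

Lemma posterior_distance_le (eta : R) : eta < 1 ->
  expR eps - 1 + (expR (C * d%:R) + 1) * expR (- (c * d%:R / 8)) * pi ^+ d <= eta ->
  (\int[lebesgue_cV R d]_(u in U)
    (`|local_posterior M prior t0 J x u - gauss_density D 1%:M u|)%:E
   <= (2 * eta)%:E)%E.
Proof.
move=> eta1 etaP.
have mU : measurable U by exact: measurable_local_space F_unit J_sqrt n_gt0.
have mf : measurable_fun setT f.
  by apply/(measurable_restrictT _ mU); exact: measurable_funM.
have mg := measurable_gauss_density D.
have eps0 : 0 <= expR eps - 1 by rewrite subr_ge0 expR_ge1.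
have mc := @measurable_cauchy_prod R d.
have dist : (\int[lebesgue_cV R d]_u (`|f u - gauss_density D 1%:M u|)%:E <= eta%:E)%E.
  set T := (expR (C * d%:R) + 1) * expR (- (c * d%:R / 8)) in etaP *.
  have T0 : 0 <= T by rewrite mulr_ge0 ?expR_ge0// addr_ge0// expR_ge0.
  apply: (@le_trans _ _ (\int[lebesgue_cV R d]_u
      ((expR eps - 1)%:E * (gauss_density D 1%:M u)%:E + T%:E * (cauchy_prod u)%:E))%E).
    apply: ge0_le_integral => //.
    - by apply/measurable_EFinP/measurableT_comp => //; exact: measurable_funB.
    - by apply: emeasurable_funD; apply: measurable_funeM; exact/measurable_EFinP.
    - by move=> u _; rewrite -!EFinM -EFinD lee_fin f_dist.
  rewrite ge0_integralD//.
  - rewrite !ge0_integralZl_EFin//.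
    + by rewrite integral_gauss_density integral_cauchy_prod mule1 -EFinM -EFinD lee_fin.
    + by move=> u _; rewrite lee_fin cauchy_prod_ge0.
    + exact/measurable_EFinP.
    + by move=> u _; rewrite lee_fin gauss_density_ge0.
    + exact/measurable_EFinP.
  - by move=> u _; rewrite -EFinM lee_fin mulr_ge0// gauss_density_ge0.
  - by apply: measurable_funeM; exact/measurable_EFinP.
  - by move=> u _; rewrite -EFinM lee_fin mulr_ge0// cauchy_prod_ge0.
  - by apply: measurable_funeM; exact/measurable_EFinP.
have [iF F0 FD] := normalized_distance_le mf mg f_ge0 (gauss_density_ge0 D)
  (integral_gauss_density D) dist eta1.
set F := \int[_]_u f u in F0 FD.
(* The unknown factor [scale] occurs in the weight and in its integral, so it cancels in
   [local_posterior]. *)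
have WE : \int[lebesgue_cV R d]_(v in U) post_weight M prior t0 J x v = scale * F.
  rewrite /F /f -Rintegral_mkcond -RintegralZl//.
    by apply: eq_Rintegral => u _; rewrite mulrC divfK// gt_eqF.
  apply/(integrable_mkcond _ mU); apply: eq_integrable iF => // u _.
  by rewrite /f /= !patchE; case: ifP.
rewrite (eq_integral (fun u => (`|f u / F - gauss_density D 1%:M u|)%:E)); last first.
  move=> u /[!inE] uU; rewrite /local_posterior WE /f patchE mem_set//.
  by congr (`|_ - _|%:E); field; rewrite !gt_eqF.
apply: le_trans FD; apply: ge0_subset_integral => //.
by apply/measurable_EFinP/measurableT_comp => //; apply: measurable_funB => //;
    exact: measurable_funM.
Qed.

End Ellipsoid.

End LocalLikelihood.

(** * Asymptotics *)

Section Hypotheses.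
Variables (R : realType) (d : nat) (M : expfam R d) (t0 : 'cV[R]_d)
  (J : 'M[R]_d) (n : nat) (prior : 'cV[R]_d -> R) (c : R).
Hypothesis t0_in : ef_Theta M t0.
Hypothesis F_unit : ef_F M t0 \in unitmx.
Hypothesis J_sqrt : is_sym_sqrt J (ef_F M t0).
Hypothesis d_gt0 : (0 < d)%N.
Hypothesis c_gt0 : 0 < c.

(** Reduces the extended-real suprema to one real inequality with a common direction [a]. The third
    moment is taken at [t0], the point of the degenerate ellipsoid of [B1] at 0 used here. *)
Lemma lambda_moment_bound (e : R) :
  (lambda M t0 J n c * (d%:R)%:E <= e%:E)%E ->
  forall a t, enorm a = 1 -> ef_ellipsoid M t0 J n c t ->
  6^-1 * (Num.sqrt (c * d%:R / n%:R) *
            `|expect M (fun y => dotp a (ef_V M J t0 y) ^+ 3) t0| +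
          c * d%:R / n%:R * expect M (fun y => dotp a (ef_V M J t y) ^+ 4) t)
  <= e / d%:R.
Proof.
move=> le a t a1 tE.
have dR : 0 < d%:R :> R by rewrite ltr0n.
have q0 : 0 <= c * d%:R / n%:R by rewrite divr_ge0// mulr_ge0// ltW.
have [tT _] := tE.
rewrite ler_pdivlMr// -lee_fin; apply: le_trans le.
rewrite EFinM; apply: lee_wpmul2r; first by rewrite lee_fin.
rewrite /lambda EFinM; apply: lee_wpmul2l; first by rewrite lee_fin.
rewrite EFinD !EFinM; apply: leeD; apply: lee_wpmul2l; rewrite ?lee_fin ?sqrtr_ge0//.
  apply: ereal_sup_ubound; exists a, t0; split=> //.
    by split=> //; rewrite subrr mulmx0 /enorm dotp0r sqrtr0 expr0n !mul0r.
  by rewrite ef_expectE//; exact: subexp_ef_V.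
apply: ereal_sup_ubound; exists a, t; split=> //.
by rewrite ef_expectE//; exact: subexp_ef_V.
Qed.

Lemma of_local_radius u : enorm u ^+ 2 <= c * d%:R ->
  enorm (of_local t0 J n u - t0) <= prior_radius M t0 n c.
Proof.
move=> uc; rewrite /prior_radius -[leLHS]ger0_norm ?enorm_ge0// -sqrtr_sqr.
apply: ler_wsqrtr; rewrite /of_local addrC addKr enormZ exprMn real_normK ?num_real//.
rewrite exprVn sqr_sqrtr// mulrC ler_wpM2r ?invr_ge0//.
apply: (le_trans (sqr_enorm_sym_sqrt_inv J_sqrt F_unit u)).
by rewrite mulrAC (mulrC (_ * _)) ler_wpM2l// opnorm_ge0.
Qed.

(** For fixed [c], the factor [ln n] in the ball assumed to lie in [Theta] eventually exceeds
    [sqrt c]. *)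
Lemma prior_radius_ball : Num.sqrt c <= ln n%:R ->
  prior_radius M t0 n c <=
  Num.sqrt (d%:R * opnorm (invmx (ef_F M t0)) / n%:R) * ln n%:R.
Proof.
move=> cn; rewrite /prior_radius -!mulrA sqrtrM ?(ltW c_gt0)// mulrC.
by rewrite (mulrCA d%:R) ler_wpM2l ?sqrtr_ge0.
Qed.

Lemma prior_local_bound (K kap : R) :
  (forall t, ef_Theta M t -> 0 <= prior t) -> 0 < prior t0 ->
  (forall t, ef_Theta M t -> enorm (t - t0) <= prior_radius M t0 n c ->
    (`|lne (prior t)%:E - lne (prior t0)%:E| <= (K * enorm (t - t0))%:E)%E) ->
  `|K * prior_radius M t0 n c| <= kap ->
  (forall u, enorm u ^+ 2 <= c * d%:R -> ef_Theta M (of_local t0 J n u)) ->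
  forall u, enorm u ^+ 2 <= c * d%:R -> 0 < prior (of_local t0 J n u) /\
    `|ln (prior (of_local t0 J n u)) - ln (prior t0)| <= kap.
Proof.
move=> pr0 p0 HK Kkap ball u uc.
set t := of_local t0 J n u; have tT : ef_Theta M t by exact: ball.
have tr := of_local_radius uc.
have := HK _ tT tr; rewrite /= [prior t0 <= 0]leNgt p0 /=.
(* A vanishing prior would have [lne] equal to [-oo], making the distance [+oo]; the finite bound
   therefore forces positivity. *)
have [|pt] := leP (prior t) 0; first by rewrite leye_eq.
rewrite -EFinB /= lee_fin => H; split=> //; apply: (le_trans H).
apply: le_trans Kkap; rewrite normrM [X in _ <= _ * X]ger0_norm ?sqrtr_ge0//.
apply: (@le_trans _ _ (`|K| * enorm (t - t0))).
  by rewrite ler_wpM2r ?enorm_ge0// ler_norm.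
by rewrite ler_wpM2l.
Qed.

Lemma prior_sup_bound (C C' : R) : 0 < prior t0 -> C <= C' ->
  (ereal_sup [set lne (prior t / prior t0)%:E | t in ef_Theta M]
    <= (C * d%:R)%:E)%E ->
  forall t, ef_Theta M t -> prior t <= prior t0 * expR (C' * d%:R).
Proof.
move=> p0 CC' supC t tT.
have : (lne (prior t / prior t0)%:E <= (C * d%:R)%:E)%E.
  by apply: le_trans supC; apply: ereal_sup_ubound; exists t.
rewrite /=; have [pt _|pt] := leP (prior t / prior t0) 0.
  have : prior t <= 0 by rewrite -(pmulr_rle0 _ (_ : 0 < (prior t0)^-1)) ?invr_gt0// mulrC.
  by move=> /le_trans; apply; rewrite mulr_ge0 ?expR_ge0// ltW.
rewrite lee_fin => H; rewrite mulrC -ler_pdivrMr// -[leLHS]lnK ?posrE//.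
by rewrite ler_expR (le_trans H)// ler_wpM2r.
Qed.

End Hypotheses.

(** Since [pi <= 4 <= expR 2], the exponents add up to at most [C d - (C + 3) d + 2 d = - d]. What
    remains is [2 * expR (- d)], which is small because [d] tends to infinity. *)
Lemma laplace_tail_le (R : realType) (d : nat) (C c tau : R) : 0 <= C ->
  8 * (C + 3) <= c -> 0 < tau -> 2 / tau <= d%:R ->
  (expR (C * d%:R) + 1) * expR (- (c * d%:R / 8)) * pi ^+ d <= tau.
Proof.
move=> C0 cC tau0 dtau.
have d0 : 0 <= d%:R :> R by [].
have h1 : expR (C * d%:R) + 1 <= 2 * expR (C * d%:R).
  by rewrite mulr_natl mulr2n lerD2l expR_ge1// mulr_ge0.
have h2 : pi ^+ d <= expR (2 * d%:R) :> R.
  rewrite expRM_natr; apply: lerXn2r; rewrite ?nnegrE ?pi_ge0 ?expR_ge0//.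
  rewrite (_ : 2 = 1 + 1)// expRD.
  have := expR_ge1Dx (1 : R); have /andP[_] := pihalf_02 R; nra.
apply: (@le_trans _ _ (2 * expR (C * d%:R) * expR (- (c * d%:R / 8)) * expR (2 * d%:R))).
  by rewrite !ler_pM// ?mulr_ge0 ?expR_ge0 ?exprn_ge0 ?pi_ge0 ?addr_ge0 ?expR_ge0.
rewrite -!mulrA -!expRD; apply: (@le_trans _ _ (2 * expR (- d%:R))).
  rewrite ler_wpM2l// ler_expR; have := ler_wpM2r d0 cC; lra.
rewrite expRN ler_pdivrMr ?expR_gt0// mulrC -ler_pdivrMr//.
by rewrite (le_trans dtau)// (le_trans _ (expR_ge1Dx _))// lerDr.
Qed.

Lemma null_support (disp : measure_display) (Omega : measurableType disp)
    (R : realType) (P : probability Omega R) (d : nat) (M : expfam R d)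
    (t0 : 'cV[R]_d) (n : nat) (X : 'I_n -> {RV P >-> 'cV[R]_d}) :
  (forall i, has_density (X i) M t0) ->
  exists2 N : set Omega, measurable N /\ P N = 0%E &
    forall w, ~ N w -> forall i, 0 < ef_h M (X i w).
Proof.
move=> XM.
pose N (k : nat) : set Omega :=
  if insub k is Some i then [set w | ef_h M (X i w) = 0] else set0.
have mN k : measurable (N k).
  rewrite /N; case: insubP => // i _ _.
  have mh := measurable_RV_comp (X i) (@ef_h_measurable _ _ M).
  by have := mh measurableT [set 0]; rewrite setTI; apply; exact: measurable_set1.
have mU : measurable (\bigcup_k N k) by exact: bigcupT_measurable.
exists (\bigcup_k N k).
  split=> //; apply: measure_negligible => //; apply: negligible_bigcup => k.
  apply/negligibleP => //; rewrite /N; case: insubP => [i _ _|_]; last exact: measure0.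
  exact: ef_h_null XM i.
move=> w Nw i; rewrite lt_neqAle ef_h_ge0 andbT eq_sym; apply/eqP => h0.
by apply: Nw; exists (val i) => //; rewrite /N valK.
Qed.

Section OneSample.
Context (disp : measure_display) (Omega : measurableType disp) (R : realType)
  (P : probability Omega R) (d : nat) (M : expfam R d) (t0 : 'cV[R]_d)
  (J : 'M[R]_d) (n : nat) (X : 'I_n -> {RV P >-> 'cV[R]_d})
  (prior : 'cV[R]_d -> R).
Hypothesis t0_in : ef_Theta M t0.
Hypothesis F_unit : ef_F M t0 \in unitmx.
Hypothesis J_sqrt : is_sym_sqrt J (ef_F M t0).
Hypothesis n_gt0 : (0 < n)%N.
Hypothesis d_gt0 : (0 < d)%N.
Hypothesis X_indep : mutually_independent X.
Hypothesis X_density : forall i, has_density (X i) M t0.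
Hypothesis prior_density : is_prior M prior.

Let Y w := (\int[lebesgue_cV R d]_(u in local_space M t0 J n)
  (`|local_posterior M prior t0 J (fun i => X i w) u -
     gauss_density (Delta M t0 J (fun i => X i w)) 1%:M u|)%:E)%E.

Lemma measurable_distance_gt (e : R) : measurable [set w | (e%:E < `|Y w|)%E].
Proof.
have mY := measurable_posterior_distance X F_unit J_sqrt n_gt0 prior_density.
have := emeasurable_fun_o_infty measurableT
  (measurableT_comp (@abse_measurable R setT) mY) e%:E.
by rewrite setTI.
Qed.

Let Y_ge0 w : (0 <= Y w)%E.
Proof. by apply: integral_ge0 => u _; rewrite lee_fin. Qed.

(** Reduces the claim to a deterministic bound off two exceptional events: a large score, of
    probability at most [K^-1], and a null set where some [ef_h] vanishes. *)
Lemma distance_prob_le (K e : R) : 0 < K ->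
  (forall w, dotp (Delta M t0 J (fun i => X i w)) (Delta M t0 J (fun i => X i w))
      <= K * d%:R ->
    (forall i, 0 < ef_h M (X i w)) -> (Y w <= e%:E)%E) ->
  (P [set w | (e%:E < `|Y w|)%E] <= (K^-1)%:E)%E.
Proof.
move=> K0 H.
have [N [mN PN] Nh] := null_support X_density.
have mT := measurable_Delta_tail X J_sqrt n_gt0 (K * d%:R).
set T := [set w | _] in mT.
apply: (@le_trans _ _ (P (T `|` N))).
  apply: le_measure; rewrite ?inE.
  - exact: measurable_distance_gt.
  - exact: measurableU.
  move=> w /=; rewrite gee0_abs// => Yw.
  have [Tw|Tw] := pselect (T w); first by left.
  right; apply: contrapT => Nw; move: Yw; rewrite ltNge => /negP; apply.
  by apply: H; [move/negP: Tw; rewrite -leNgt|exact: Nh].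
apply: (le_trans (measureU2 P mT mN)).
rewrite [X in (_ + X)%E](_ : _ = 0%E)// adde0.
exact: (Delta_tail t0_in F_unit J_sqrt X_indep X_density n_gt0 K0 d_gt0).
Qed.

Lemma measurable_post_weight_local w :
  measurable_fun (local_space M t0 J n) (post_weight M prior t0 J (fun i => X i w)).
Proof.
have mp := measurable_post_weight X F_unit J_sqrt n_gt0 prior_density.
have mU := measurable_local_space F_unit J_sqrt n_gt0.
have mD : measurable ((@snd Omega 'cV[R]_d) @^-1` local_space M t0 J n).
  by rewrite -[X in measurable X]setTI; exact: measurable_snd.
have mc : measurable_fun (local_space M t0 J n) (fun u : 'cV[R]_d => (w, u)).
  by apply: measurable_funTS; exact: measurable_fun_pair.
apply: (measurable_comp mD _ mp mc).
by move=> _ [u uU <-].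
Qed.

End OneSample.

Theorem theorem1 (R : realType)
    (d : nat -> nat) (M : forall n, expfam R (d n))
    (theta0 : forall n, 'cV[R]_(d n)) (J : forall n, 'M[R]_(d n))
    (prior : forall n, 'cV[R]_(d n) -> R)
    (disp : nat -> measure_display)
    (Omega : forall n, measurableType (disp n))
    (P : forall n, probability (Omega n) R)
    (X : forall n, 'I_n -> {RV (P n) >-> 'cV[R]_(d n)})
    (d_oo : d n @[n --> \oo] --> \oo)
    (theta0_in : forall n, ef_Theta (M n) (theta0 n))
    (F_inv : forall n, ef_F (M n) (theta0 n) \in unitmx)
    (J_sqrt : forall n, is_sym_sqrt (J n) (ef_F (M n) (theta0 n)))
    (ball_sub : forall n,
      eball (theta0 n)
        (Num.sqrt ((d n)%:R * opnorm (invmx (ef_F (M n) (theta0 n))) / n%:R)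
           * ln n%:R)
      `<=` ef_Theta (M n))
    (X_indep : forall n, mutually_independent (X n))
    (X_density : forall n i, has_density (X n i) (M n) (theta0 n))
    (prior_density : forall n, is_prior (M n) (prior n))
    (cond : forall c : R, 0 < c ->
      [/\ (B1 (M n) (theta0 n) (J n) n c *
             (Num.sqrt ((d n)%:R / n%:R))%:E)%E @[n --> \oo] --> 0%E,
          (lambda (M n) (theta0 n) (J n) n c * ((d n)%:R)%:E)%E
            @[n --> \oo] --> 0%E,
          opnorm (invmx (ef_F (M n) (theta0 n))) * (d n)%:R / n%:R
            @[n --> \oo] --> 0 &
          assumption_P M theta0 prior (fun=> c)]) :
  is_op1 P (fun n w =>
    \int[lebesgue_cV R (d n)]_(u in local_space (M n) (theta0 n) (J n) n)
      (`|local_posterior (M n) (prior n) (theta0 n) (J n) (fun i => X n i w) u -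
         gauss_density (Delta (M n) (theta0 n) (J n) (fun i => X n i w))
           1%:M u|)%:E)%E.
Proof.
move=> e e0.
(* The value 1 is arbitrary: [c] does not enter the clause that yields [C]. *)
have [_ _ _ [p0 [C supC] _]] := cond 1 ltr01.
(* The final bound is [2 * tau], to be at most [e], and normalisation requires [tau < 1]. Half of
   [tau] goes to the ball, through [expR eps - 1 = tau / 2], and half to the tail. *)
pose tau : R := Num.min (e / 2) 2^-1.
have tau0 : 0 < tau by rewrite lt_min divr_gt0//= invr_gt0.
pose eps : R := ln (1 + tau / 2).
have tau2 : 1 < 1 + tau / 2 by rewrite ltrDl divr_gt0.
have epsE : expR eps = 1 + tau / 2 by rewrite lnK// posrE (lt_trans _ tau2).
have eps0 : 0 < eps by exact: ln_gt0.
pose C' : R := Num.max C 0.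
have C'0 : 0 <= C' by rewrite le_max lexx orbT.
have CC' : C <= C' by rewrite le_max lexx.
have core (delta : R) : 0 < delta -> \forall n \near \oo,
    let A := [set w | (e%:E < `|\int[lebesgue_cV R (d n)]_
      (u in local_space (M n) (theta0 n) (J n) n)
      (`|local_posterior (M n) (prior n) (theta0 n) (J n) (fun i => X n i w) u -
         gauss_density (Delta (M n) (theta0 n) (J n) (fun i => X n i w))
           1%:M u|)%:E|)%E] in
    measurable A /\ (P n A <= delta%:E)%E.
  move=> delta0; pose K := delta^-1.
  have K0 : 0 < K by rewrite invr_gt0.
  (* The three lower bounds serve the Cauchy majorant, the score bound at level [K], and the tail
     against the prior factor. *)
  pose c : R := Num.max 256 (Num.max (64 * K) (8 * (C' + 3))).
  have c256 : 256 <= c by rewrite le_max lexx.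
  have cK : 64 * K <= c by rewrite !le_max lexx orbT.
  have cC : 8 * (C' + 3) <= c by rewrite !le_max lexx !orbT.
  have c0 : 0 < c by rewrite (lt_le_trans _ c256).
  have [_ Hlam _ [_ _ [Kn [HK HK0]]]] := cond c c0.
  (* With [lam = e1 / d], the first bound gives [lam <= 1/8], as [d >= 1], and the second
     [lam * (c * d) <= eps / 2], leaving [eps / 2] for the prior. *)
  pose e1 : R := Num.min 8^-1 (eps / 2 / c).
  have e10 : 0 < e1 by rewrite lt_min invr_gt0 ltr0n/= !divr_gt0.
  have /fine_cvgP[lamfin /cvgrPdist_le lam0] := Hlam.
  move/cvgrPdist_le : HK0 => HK0.
  near=> n.
  have n0 : (0 < n)%N by near: n; exact: nbhs_infty_gt.
  have d0 : (0 < d n)%N by near: n; apply: (d_oo [set k | (0 < k)%N]); exact: nbhs_infty_gt.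
  have dtau : 2 / (tau / 2) <= (d n)%:R.
    by near: n; apply: (d_oo [set k | 2 / (tau / 2) <= k%:R]); exact: nbhs_infty_ger.
  have lnn : Num.sqrt c <= ln n%:R.
    have : expR (Num.sqrt c) <= n%:R by near: n; exact: nbhs_infty_ger.
    by move=> h; rewrite -[leLHS]expRK ler_ln// posrE ?expR_gt0// ltr0n.
  have lamE : (lambda (M n) (theta0 n) (J n) n c * ((d n)%:R)%:E <= e1%:E)%E.
    have fin : (lambda (M n) (theta0 n) (J n) n c * ((d n)%:R)%:E)%E \is a fin_num.
      by near: n.
    rewrite -(fineK fin) lee_fin (le_trans (ler_norm _))// -normrN -sub0r.
    by near: n; exact: lam0.
  have kapE : `|Kn n * prior_radius (M n) (theta0 n) n c| <= eps / 2.
    rewrite -normrN -sub0r; near: n; apply: HK0; exact: divr_gt0.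
  have supn : (ereal_sup [set lne (prior n t / prior n (theta0 n))%:E
      | t in ef_Theta (M n)] <= (C * (d n)%:R)%:E)%E by near: n.
  have dR : 0 < (d n)%:R :> R by rewrite ltr0n.
  have d1 : 1 <= (d n)%:R :> R by rewrite ler1n.
  have ball u : enorm u ^+ 2 <= c * (d n)%:R ->
      ef_Theta (M n) (of_local (theta0 n) (J n) n u).
    move=> uc; apply: ball_sub; rewrite /eball /=.
    apply: (le_trans (of_local_radius n (F_inv n) (J_sqrt n) uc)).
    exact: prior_radius_ball.
  split; first exact: measurable_distance_gt.
  rewrite -[delta]invrK -/K; apply: distance_prob_le => // w Dw hw.
  have le2 : ((2 * tau)%:E <= e%:E)%E.
    by rewrite lee_fin mulrC -ler_pdivlMr// ge_min lexx.
  apply: le_trans le2.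
  apply: (@posterior_distance_le R (d n) (M n) (theta0 n) (J n) n (fun i => X n i w)
    (prior n) _ _ _ _ _ _ _ _ c (e1 / (d n)%:R) _ _ _ K C' eps (eps / 2)) => //.
  - exact: lambda_moment_bound.
  - rewrite ler_pdivrMr// (@le_trans _ _ 8^-1)//; first by rewrite ge_min lexx.
    by rewrite ler_peMr// invr_ge0.
  - rewrite mulrCA divfK ?gt_eqF// [leRHS]splitr lerD2r mulrC -ler_pdivlMr//.
    by rewrite ge_min lexx orbT.
  - apply: (prior_local_bound (F_inv n) (J_sqrt n) _ _ (HK n) kapE) => //.
    by case: (prior_density n).
  - exact: prior_sup_bound supn.
  - exact: measurable_post_weight_local.
  - by rewrite (@le_lt_trans _ _ 2^-1)// ?ge_min ?lexx ?orbT// invf_lt1// ltr1n.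
  - rewrite epsE [1 + _]addrC addrK [leRHS]splitr lerD2l.
    by apply: laplace_tail_le => //; exact: divr_gt0.
apply/fine_cvgP; split.
  have := core 1 ltr01; apply: filterS => n [mA _].
  exact: fin_num_measure.
apply/cvgrPdist_le => delta delta0.
have := core delta delta0; apply: filterS => n [mA PA].
rewrite sub0r normrN ger0_norm ?fine_ge0// -lee_fin fineK//.
exact: fin_num_measure.
Unshelve. all: by end_near. Qed.
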